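(* For $k\ge 2$, $i\mathsf{RCA}_0^\omega$ proves $\mathsf{LPO}\le_W \mathsf{TGC}k \le_W \widehat{\mathsf{LPO}}$.
   Context: $i\mathsf{RCA}_0^\omega$ is Kohlenbach's higher-order base system $\mathsf{RCA}_0^\omega$ with intuitionistic logic. Graphs have vertex set $\mathbb N$, coded by functions $e:\mathbb N\to\mathbb N$ via a fixed primitive recursive bijection of $\mathbb N$ onto $\{(a,b):a<b\}$; $G_m$ is the subgraph on vertices $\{0,\dots,m\}$; a $k$-coloring is a map to $\{0,\dots,k-1\}$ giving adjacent vertices distinct values. $\mathsf{TGC}k$ (total $k$-coloring): given any graph $G$, output $f:\mathbb N\to\mathbb N$ such that if $f(0)=0$ then $f$ is a $k$-coloring of $G$, and if $f(0)>0$ then $G_{f(0)}$ has no $k$-coloring. $\mathsf{LPO}$: given $p:\mathbb N\to\mathbb N$, output $n$ with: if $n=0$ then $p(j)>0$ for all $j$; if $n>0$ then $p(n-1)=0$ and $p(t)>0$ for all $t<n-1$. $\widehat{\mathsf{LPO}}$ takes a sequence of $\mathsf{LPO}$-inputs and outputs the sequence of corresponding solutions. For total problems $\mathsf P:\forall x\exists y\,P(x,y)$ and $\mathsf Q:\forall u\exists v\,Q(u,v)$, formalized $\mathsf Q\le_W\mathsf P$ is $\exists\Phi\exists\Psi\forall u\forall y\,(P(\Phi(u),y)\to Q(u,\Psi(y)))$ with $\Phi,\Psi$ functionals of type $1\to1$.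
   Formalization: In LPO ≤_W TGCk the backward functional Ψ may also use the original input u (standard Weihrauch reducibility); with Ψ seeing only y, as in the stated formula, this half is not provable, since it fails in the continuous functionals. The second half keeps the stated formula. *)

(* Defs.v *)
(** Higher-order arithmetic is embedded deeply: typed combinator terms, formulas
    over them, and an inductive provability predicate for the intuitionistic
    base theory. *)
From Stdlib Require Import List.
Import ListNotations.

Set Implicit Arguments.

Inductive ty : Set := N | Arr (s t : ty).

Notation one := (Arr N N).

Definition ctx := list ty.

(** Well-typed de Bruijn variables: the head of the context is the innermost one. *)
Inductive var : ctx -> ty -> Type :=
| VZ : forall G s, var (s :: G) s
| VS : forall G s t, var G t -> var (s :: G) t.
Arguments VZ {G s}.
Arguments VS {G s t} _.

(** [Rec] is the type-0 recursor [R_0]; no recursor of higher type is available. *)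
Inductive tm (G : ctx) : ty -> Type :=
| Var : forall t, var G t -> tm G t
| App : forall s t, tm G (Arr s t) -> tm G s -> tm G t
| Zero : tm G N
| Succ : tm G (Arr N N)
| Pi : forall s t, tm G (Arr s (Arr t s))
| Sigma : forall r s t,
    tm G (Arr (Arr r (Arr s t)) (Arr (Arr r s) (Arr r t)))
| Rec : tm G (Arr N (Arr N (Arr (Arr N (Arr N N)) N))).
Arguments Var {G t} _.
Arguments App {G s t} _ _.
Arguments Zero {G}.
Arguments Succ {G}.
Arguments Pi {G} s t.
Arguments Sigma {G} r s t.
Arguments Rec {G}.

Declare Scope ho_scope.
Delimit Scope ho_scope with ho.
Bind Scope ho_scope with tm.
Notation "f @ a" := (App f a) (at level 28, left associativity) : ho_scope.
Open Scope ho_scope.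

Notation v0 := (Var VZ).
Notation v1 := (Var (VS VZ)).
Notation v2 := (Var (VS (VS VZ))).

Definition sub (G D : ctx) : Type := forall t, var G t -> tm D t.

Fixpoint tsubst {G D} (f : sub G D) {t} (a : tm G t) : tm D t :=
  match a with
  | Var x => f _ x
  | App b c => tsubst f b @ tsubst f c
  | Zero => Zero
  | Succ => Succ
  | Pi s t => Pi s t
  | Sigma r s t => Sigma r s t
  | Rec => Rec
  end.

Definition idsub {G} : sub G G := fun t x => Var x.

Definition shift {G} (s : ty) : sub G (s :: G) := fun t x => Var (VS x).

Definition scons {D s G} (a : tm D s) (f : sub G D) : sub (s :: G) D :=
  fun t x =>
    match x in var E t
      return match E with
             | [] => unit
             | s :: G => tm D s -> sub G D -> tm D t
             end
    with
    | VZ => fun a _ => a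
    | VS y => fun _ f => f _ y
    end a f.

Definition wk {G} {s t} (a : tm G t) : tm (s :: G) t := tsubst (shift s) a.

Definition up {G D} s (f : sub G D) : sub (s :: G) (s :: D) :=
  scons v0 (fun t x => wk (f t x)).

(** Prime formulas are equations between terms of type 0 only. *)
Inductive fm (G : ctx) : Type :=
| Eq : tm G N -> tm G N -> fm G
| Bot : fm G
| And : fm G -> fm G -> fm G
| Or : fm G -> fm G -> fm G
| Imp : fm G -> fm G -> fm G
| All : forall s, fm (s :: G) -> fm G
| Ex : forall s, fm (s :: G) -> fm G.
Arguments Bot {G}.
Arguments All {G} s _.
Arguments Ex {G} s _.

Definition Neg {G} (A : fm G) : fm G := Imp A Bot.

Fixpoint fsubst {G D} (f : sub G D) (A : fm G) : fm D :=
  match A with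
  | Eq a b => Eq (tsubst f a) (tsubst f b)
  | Bot => Bot
  | And A B => And (fsubst f A) (fsubst f B)
  | Or A B => Or (fsubst f A) (fsubst f B)
  | Imp A B => Imp (fsubst f A) (fsubst f B)
  | All s A => All s (fsubst (up f) A)
  | Ex s A => Ex s (fsubst (up f) A)
  end.

Definition fwk {G s} (A : fm G) : fm (s :: G) := fsubst (shift s) A.

Definition inst {G s} (A : fm (s :: G)) (a : tm G s) : fm G :=
  fsubst (scons a idsub) A.

Fixpoint qfree {G} (A : fm G) : Prop :=
  match A with
  | Eq _ _ | Bot => True
  | And A B | Or A B | Imp A B => qfree A /\ qfree B
  | All _ _ | Ex _ _ => False
  end.

(** Equality at higher types is an abbreviation for pointwise equality. *)
Fixpoint eqt {G} (t : ty) : tm G t -> tm G t -> fm G :=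
  match t with
  | N => fun a b => Eq a b
  | Arr s t => fun a b => All s (eqt (wk a @ v0) (wk b @ v0))
  end.

(** Nonlogical axioms, as schemata in the free variables of the context: equality
    and successor, the defining equations of the constants, extensionality in all
    types, quantifier-free induction, and QF-AC of type (1,0). *)
Inductive axiom (G : ctx) : fm G -> Prop :=
| ax_refl : forall a : tm G N, axiom (Eq a a)
| ax_sym : forall a b : tm G N, axiom (Imp (Eq a b) (Eq b a))
| ax_trans : forall a b c : tm G N,
    axiom (Imp (Eq a b) (Imp (Eq b c) (Eq a c)))
| ax_succ_zero : forall a : tm G N, axiom (Neg (Eq (Succ @ a) Zero))
| ax_succ_inj : forall a b : tm G N,
    axiom (Imp (Eq (Succ @ a) (Succ @ b)) (Eq a b))
| ax_pi : forall s t (a : tm G s) (b : tm G t),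
    axiom (eqt (Pi s t @ a @ b) a)
| ax_sigma : forall r s t (a : tm G (Arr r (Arr s t))) (b : tm G (Arr r s))
    (c : tm G r),
    axiom (eqt (Sigma r s t @ a @ b @ c) (a @ c @ (b @ c)))
| ax_rec_zero : forall (b : tm G N) (c : tm G (Arr N (Arr N N))),
    axiom (Eq (Rec @ Zero @ b @ c) b)
| ax_rec_succ : forall (a b : tm G N) (c : tm G (Arr N (Arr N N))),
    axiom (Eq (Rec @ (Succ @ a) @ b @ c) (c @ (Rec @ a @ b @ c) @ a))
| ax_ext : forall s t (f : tm G (Arr s t)) (a b : tm G s),
    axiom (Imp (eqt a b) (eqt (f @ a) (f @ b)))
| ax_qf_ind : forall A : fm (N :: G), qfree A ->
    axiom (Imp (And (inst A Zero)
                    (All N (Imp A (fsubst (scons (Succ @ v0) (shift N)) A))))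
               (All N A))
(** In [A], [v0] is the number and [v1] the function; in the conclusion, [v0] is
    the function and [v1] the choice functional. *)
| ax_qf_ac : forall A : fm (N :: one :: G), qfree A ->
    axiom (Imp (All one (Ex N A))
               (Ex (Arr one N) (All one
                  (fsubst (scons (v1 @ v0)
                          (scons v0 (fun t x => Var (VS (VS x))))) A)))).

(** Natural deduction for many-sorted intuitionistic logic. *)
Inductive prov : forall G : ctx, list (fm G) -> fm G -> Prop :=
| p_ax : forall G (H : list (fm G)) A, axiom A -> prov H A
| p_hyp : forall G (H : list (fm G)) A, In A H -> prov H A
| p_botE : forall G (H : list (fm G)) A, prov H Bot -> prov H A
| p_andI : forall G (H : list (fm G)) A B, prov H A -> prov H B -> prov H (And A B)
| p_andE1 : forall G (H : list (fm G)) A B, prov H (And A B) -> prov H A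
| p_andE2 : forall G (H : list (fm G)) A B, prov H (And A B) -> prov H B
| p_orI1 : forall G (H : list (fm G)) A B, prov H A -> prov H (Or A B)
| p_orI2 : forall G (H : list (fm G)) A B, prov H B -> prov H (Or A B)
| p_orE : forall G (H : list (fm G)) A B C,
    prov H (Or A B) -> prov (A :: H) C -> prov (B :: H) C -> prov H C
| p_impI : forall G (H : list (fm G)) A B, prov (A :: H) B -> prov H (Imp A B)
| p_impE : forall G (H : list (fm G)) A B, prov H (Imp A B) -> prov H A -> prov H B
| p_allI : forall G (H : list (fm G)) s (A : fm (s :: G)),
    prov (map fwk H) A -> prov H (All s A)
| p_allE : forall G (H : list (fm G)) s (A : fm (s :: G)) (a : tm G s),
    prov H (All s A) -> prov H (inst A a)
| p_exI : forall G (H : list (fm G)) s (A : fm (s :: G)) (a : tm G s),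
    prov H (inst A a) -> prov H (Ex s A)
| p_exE : forall G (H : list (fm G)) s (A : fm (s :: G)) (B : fm G),
    prov H (Ex s A) -> prov (A :: map fwk H) (fwk B) -> prov H B.

Definition iRCA0w_proves (A : fm []) : Prop := prov [] A.

(** Abstraction is not primitive: [lam] is the usual bracket abstraction. *)
Definition lam_var {s G t} (x : var (s :: G) t) : tm G (Arr s t) :=
  match x in var E t
    return match E with [] => unit | s :: G => tm G (Arr s t) end
  with
  | @VZ G s => Sigma s (Arr s s) s @ Pi s (Arr s s) @ Pi s s
  | @VS G s t y => Pi t s @ Var y
  end.

Fixpoint lam {s G t} (a : tm (s :: G) t) : tm G (Arr s t) :=
  match a in tm _ t return tm G (Arr s t) with
  | Var x => lam_var x
  | App b c => Sigma _ _ _ @ lam b @ lam c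
  | Zero => Pi _ _ @ Zero
  | Succ => Pi _ _ @ Succ
  | Pi r t => Pi _ _ @ Pi r t
  | Sigma r u t => Pi _ _ @ Sigma r u t
  | Rec => Pi _ _ @ Rec
  end.

Fixpoint numeral {G} (n : nat) : tm G N :=
  match n with O => Zero | S n => Succ @ numeral n end.

Definition add {G} (a b : tm G N) : tm G N :=
  Rec @ a @ b @ lam (lam (Succ @ v1)).

Definition pred {G} (a : tm G N) : tm G N :=
  Rec @ a @ Zero @ lam (lam v0).

(** Truncated subtraction. *)
Definition monus {G} (a b : tm G N) : tm G N :=
  Rec @ b @ a @ lam (lam (pred v1)).

(** [tri n] is [0 + 1 + ... + (n - 1)]. *)
Definition tri {G} (a : tm G N) : tm G N :=
  Rec @ a @ Zero @ lam (lam (add v1 v0)).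

Definition le {G} (a b : tm G N) : fm G := Eq (monus a b) Zero.

Definition lt {G} (a b : tm G N) : fm G := le (Succ @ a) b.

(** Inverse of the bijection from the naturals onto the pairs [a < b]: the edge
    [{a, b}] has number [b (b - 1) / 2 + a]. *)
Definition edge {G} (a b : tm G N) : tm G N := add (tri b) a.

(** Cantor pairing, a bijection between all pairs and the naturals. *)
Definition pair {G} (i j : tm G N) : tm G N := edge i (Succ @ add i j).

(** [p |-> i |-> j |-> p (pair i j)]: the sequence of functions coded by [p]. *)
Definition section {G} : tm G (Arr one (Arr N one)) :=
  lam (lam (lam (v2 @ pair v1 v0))).

(** The graph coded by [e] has the edge numbered [n] iff [e n > 0]. *)
Definition coloring (k : nat) {G} (e f : tm G one) : fm G :=
  And (All N (lt (wk f @ v0) (numeral k)))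
      (All N (All N
        (Imp (lt v1 v0)
        (Imp (lt Zero (wk (wk e) @ edge v1 v0))
             (Neg (Eq (wk (wk f) @ v1) (wk (wk f) @ v0))))))).

(** Colorings of the subgraph on [{0, ..., m}], given by the values on
    [{0, ..., m}] of a function [c]. *)
Definition coloring_upto (k : nat) {G} (e : tm G one) (m : tm G N)
    (c : tm G one) : fm G :=
  And (All N (Imp (le v0 (wk m)) (lt (wk c @ v0) (numeral k))))
      (All N (All N
        (Imp (le v1 (wk (wk m)))
        (Imp (le v0 (wk (wk m)))
        (Imp (lt v1 v0)
        (Imp (lt Zero (wk (wk e) @ edge v1 v0))
             (Neg (Eq (wk (wk c) @ v1) (wk (wk c) @ v0))))))))).

(** A problem is a formula in an input [v1] and an output [v0], both of type 1. *)
Definition problem := fm [one; one].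

Definition holds (P : problem) {G} (x y : tm G one) : fm G :=
  fsubst (scons y (scons x (fun t (z : var [] t) =>
            match z in var E _ return match E with [] => tm G t | _ => unit end
            with VZ => tt | VS _ => tt end))) P.

Definition TGC (k : nat) : problem :=
  And (Imp (Eq (v0 @ Zero) Zero) (coloring k v1 v0))
      (Imp (lt Zero (v0 @ Zero))
           (Neg (Ex one (coloring_upto k v2 (v1 @ Zero) v0)))).

Definition lpo {G} (p : tm G one) (n : tm G N) : fm G :=
  And (Imp (Eq n Zero) (All N (lt Zero (wk p @ v0))))
      (Imp (lt Zero n)
           (And (Eq (p @ pred n) Zero)
                (All N (Imp (lt v0 (pred (wk n))) (lt Zero (wk p @ v0)))))).

(** The number output by LPO is the value at 0 of the type-1 output. *)
Definition LPO : problem := lpo v1 (v0 @ Zero).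

Definition LPO_hat : problem :=
  All N (lpo (section @ v2 @ v0) (v1 @ v0)).

(** Weihrauch reducibility of [Q] to [P]: the backward functional may use the
    original input [u]. In [wle] it has type 1 -> (1 -> 1), and [Psi u] is a
    functional of type 1 -> 1. *)
Definition wle (Q P : problem) : fm [] :=
  Ex (Arr one one) (Ex (Arr one (Arr one one)) (All one (All one
    (let Phi := Var (VS (VS (VS VZ))) in let Psi := v2 in
     let u := v1 in let y := v0 in
     Imp (holds P (Phi @ u) y) (holds Q u (Psi @ u @ y)))))).

(** The strong form: [Psi] has type 1 -> 1 and sees only the solution [y]. It
    implies [wle]. For LPO and TGC it fails in the continuous functionals, a model
    of the theory: by continuity and compactness, [Phi] sends inputs with distinct
    LPO answers to graphs that are not k-colorable, and two such graphs share a
    constant TGC solution [y]. *)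
Definition swle (Q P : problem) : fm [] :=
  Ex (Arr one one) (Ex (Arr one one) (All one (All one
    (let Phi := Var (VS (VS (VS VZ))) in let Psi := v2 in
     let u := v1 in let y := v0 in
     Imp (holds P (Phi @ u) y) (holds Q u (Psi @ y)))))).

(* Main.v *)
(** For LPO, the graph has an edge as soon as [p] has a zero below the number of
    this edge: without a zero it has no edges, and after a zero [j] the vertices
    beyond [j] form a clique, too large for [k] colors. If a subgraph is not
    colorable then it has an edge, so the zero is found by a bounded search.

    For colorings, an LPO question for each coloring of an initial segment of the
    vertices asks whether it extends to every larger initial segment. The answers
    for the [k] one-vertex extensions of an extendible coloring cannot all be
    negative, for the finitely many refuting stages have a common bound. So the
    answers alone guide a path through the tree of colorings, and "its current
    node is answered positively" is a quantifier-free invariant, as needed for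
    the induction available. *)
From Stdlib Require Import List Lia Setoid Morphisms.
Import ListNotations.
Require Import Defs.

Set Implicit Arguments.

(** * Substitution *)

(** Rocq is the metatheory: lemmas hold for every variable context and hypothesis list, and
    implications of the object theory are proved as in Kripke models, by passing to an arbitrary
    stronger list. The number [k] is standard, so the pigeonhole argument and the common bound for
    the [k] extensions are recursions of the metatheory and call for no internal induction or
    collection. Bounded existence is decided by a search term, so witnesses are explicit terms.

    For such a search, colorings of initial segments have to be single numbers: they are digit
    strings in base [k], and k^(m+1) - 1 bounds the colorings of {0, ..., m}. Since the sequence of
    LPO inputs is read through a fixed pairing, the stage [j] of a question is the argument
    [pair (pair n s) j], and this same number serves as the last vertex of the subgraph to be
    colored. It determines its question and is at least [n] and [j], so stages of different
    questions are compared by restricting colorings. *)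

Definition var_case s G (P : forall t, var (s :: G) t -> Prop)
    (HZ : P s VZ) (HS : forall t (y : var G t), P t (VS y)) :
    forall t (x : var (s :: G) t), P t x :=
  fun t x =>
    match x as x' in var E t'
      return match E return var E t' -> Prop with
             | [] => fun _ => True
             | s' :: G' => fun x' =>
                 forall P : forall t, var (s' :: G') t -> Prop,
                 P s' VZ -> (forall t (y : var G' t), P t (VS y)) -> P t' x'
             end x'
    with
    | VZ => fun P HZ _ => HZ
    | VS y => fun P _ HS => HS _ y
    end P HZ HS.

Lemma tsubst_ext G D (f g : sub G D) t (a : tm G t) :
  (forall t x, f t x = g t x) -> tsubst f a = tsubst g a.
Proof. intros E; induction a; simpl; congruence. Qed.

Lemma tsubst_comp G D E (f : sub G D) (g : sub D E) t (a : tm G t) :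
  tsubst g (tsubst f a) = tsubst (fun t x => tsubst g (f t x)) a.
Proof. induction a; simpl; congruence. Qed.

Lemma tsubst_id G t (a : tm G t) : tsubst idsub a = a.
Proof. induction a; simpl; unfold idsub in *; congruence. Qed.

Lemma tsubst_scons_wk G D s (b : tm D s) (f : sub G D) t (a : tm G t) :
  tsubst (scons b f) (wk a) = tsubst f a.
Proof. unfold wk; rewrite tsubst_comp; now apply tsubst_ext. Qed.

Lemma tsubst_inst_wk G s (b : tm G s) t (a : tm G t) :
  tsubst (scons b idsub) (wk a) = a.
Proof. now rewrite tsubst_scons_wk, tsubst_id. Qed.

Lemma tsubst_up_wk G D s (f : sub G D) t (a : tm G t) :
  tsubst (up (s := s) f) (wk a) = wk (tsubst f a).
Proof.
  unfold up; rewrite tsubst_scons_wk; unfold wk at 2; rewrite tsubst_comp.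
  reflexivity.
Qed.

Lemma up_ext G D s (f g : sub G D) :
  (forall t x, f t x = g t x) ->
  forall t (x : var (s :: G) t), up f x = up g x.
Proof.
  intros E; refine (var_case _ _ _); [reflexivity|].
  intros t y; cbn; now rewrite E.
Qed.

Lemma fsubst_ext G (A : fm G) : forall D (f g : sub G D),
  (forall t x, f t x = g t x) -> fsubst f A = fsubst g A.
Proof.
  induction A; intros D f g E; simpl; f_equal; auto using tsubst_ext, up_ext.
Qed.

Lemma fsubst_comp G (A : fm G) : forall D E (f : sub G D) (g : sub D E),
  fsubst g (fsubst f A) = fsubst (fun t x => tsubst g (f t x)) A.
Proof.
  induction A; intros D E f g; simpl; f_equal; auto using tsubst_comp.
  all: rewrite IHA; apply fsubst_ext; refine (var_case _ _ _); [reflexivity|].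
  all: intros t y; exact (tsubst_up_wk _ g (f t y)).
Qed.

Lemma fsubst_id G (A : fm G) : forall f : sub G G,
  (forall t x, f t x = Var x) -> fsubst f A = A.
Proof.
  induction A; intros f E; simpl; f_equal; auto.
  1,2: (rewrite <- (tsubst_id t) at 2 || rewrite <- (tsubst_id t0) at 2);
       now apply tsubst_ext.
  all: apply IHA; refine (var_case _ _ _); [reflexivity|];
       intros t y; cbn; now rewrite E.
Qed.

Lemma fsubst_up_fwk G D s (f : sub G D) (A : fm G) :
  fsubst (up (s := s) f) (fwk A) = fwk (fsubst f A).
Proof. unfold fwk; rewrite !fsubst_comp; now apply fsubst_ext. Qed.

Lemma fsubst_inst G D s (f : sub G D) (A : fm (s :: G)) a :
  fsubst f (inst A a) = inst (fsubst (up f) A) (tsubst f a).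
Proof.
  unfold inst; rewrite !fsubst_comp; apply fsubst_ext.
  refine (var_case _ _ _); [reflexivity|].
  intros t y; cbn. fold (@wk D s t (f t y)). now rewrite tsubst_inst_wk.
Qed.

Lemma inst_up_shift G s (A : fm (s :: G)) :
  inst (fsubst (up (shift s)) A) v0 = A.
Proof.
  unfold inst; rewrite fsubst_comp; apply fsubst_id.
  now refine (var_case _ _ _).
Qed.

Lemma fsubst_eqt t : forall G D (f : sub G D) (a b : tm G t),
  fsubst f (eqt a b) = eqt (tsubst f a) (tsubst f b).
Proof.
  induction t; intros; simpl; [reflexivity|].
  rewrite IHt2; simpl. now rewrite !tsubst_up_wk.
Qed.

Lemma qfree_fsubst G (A : fm G) : forall D (f : sub G D),
  qfree A -> qfree (fsubst f A).
Proof. induction A; simpl; intuition. Qed.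

(** All axioms are schemata in their free variables; only the two that move variables themselves,
    induction and choice, leave an identity between substitutions to check. *)
Lemma axiom_fsubst G D (f : sub G D) (A : fm G) : axiom A -> axiom (fsubst f A).
Proof.
  intros [ | | | | | | | | | | A' q | A' q]; simpl; rewrite ?fsubst_eqt; simpl.
  all: try (constructor; fail).
  - rewrite !fsubst_inst; simpl.
    replace (fsubst (up f) (fsubst (scons (Succ @ v0) (shift N)) A'))
      with (fsubst (scons (Succ @ v0) (shift N)) (fsubst (up f) A')).
    + now apply ax_qf_ind, qfree_fsubst.
    + rewrite !fsubst_comp; apply fsubst_ext.
      refine (var_case _ _ _); [reflexivity|].
      intros t y; cbn. fold (@wk D N t (f t y)).
      now rewrite tsubst_scons_wk.
  - match goal with |- axiom (Imp (All one (Ex N ?X)) (Ex _ (All one ?Y))) =>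
      replace Y with (fsubst (scons (v1 @ v0)
                          (scons v0 (fun t x => Var (VS (VS x))))) X)
    end.
    + now apply ax_qf_ac, qfree_fsubst.
    + rewrite !fsubst_comp; apply fsubst_ext.
      refine (var_case _ _ _); [reflexivity|].
      refine (var_case _ _ _); [reflexivity|].
      intros t y; cbn. unfold wk; rewrite !tsubst_comp. now apply tsubst_ext.
Qed.

(** * Weakening and substitution for derivations *)

Lemma prov_weaken G (H : list (fm G)) A :
  prov H A -> forall H', incl H H' -> prov H' A.
Proof.
  induction 1; intros H' I.
  - now apply p_ax.
  - now apply p_hyp, I.
  - now apply p_botE, IHprov.
  - now apply p_andI; [apply IHprov1 | apply IHprov2].
  - eapply p_andE1; eauto.
  - eapply p_andE2; eauto.
  - apply p_orI1; eauto.
  - apply p_orI2; eauto.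
  - eapply p_orE; [eauto | apply IHprov2 | apply IHprov3];
      apply incl_cons; simpl; auto using incl_tl.
  - apply p_impI, IHprov, incl_cons; simpl; auto using incl_tl.
  - eapply p_impE; eauto.
  - apply p_allI, IHprov, incl_map, I.
  - apply p_allE; eauto.
  - eapply p_exI; eauto.
  - eapply p_exE; [eauto | apply IHprov2].
    apply incl_cons; simpl; auto using incl_tl, incl_map.
Qed.

Lemma map_fwk_fsubst G D s (f : sub G D) (H : list (fm G)) :
  map fwk (map (fsubst f) H) = map (fsubst (up (s := s) f)) (map fwk H).
Proof.
  rewrite !map_map; apply map_ext; intros; now rewrite fsubst_up_fwk.
Qed.

(** What is wanted later is weakening, but below a quantifier a shift turns into [up] of a shift, so
    the induction runs over all substitutions. *)
Lemma prov_fsubst G (H : list (fm G)) A :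
  prov H A -> forall D (f : sub G D), prov (map (fsubst f) H) (fsubst f A).
Proof.
  induction 1; intros D f; simpl in *.
  - now apply p_ax, axiom_fsubst.
  - now apply p_hyp, in_map.
  - apply p_botE, IHprov.
  - apply p_andI; auto.
  - eapply p_andE1; eauto.
  - eapply p_andE2; eauto.
  - apply p_orI1; eauto.
  - apply p_orI2; eauto.
  - eapply p_orE; eauto.
  - apply p_impI; auto.
  - eapply p_impE; eauto.
  - apply p_allI. rewrite map_fwk_fsubst. exact (IHprov _ (up f)).
  - rewrite fsubst_inst. now apply p_allE, IHprov.
  - eapply p_exI. specialize (IHprov _ f). rewrite fsubst_inst in IHprov.
    exact IHprov.
  - eapply p_exE; [apply IHprov1|]. specialize (IHprov2 _ (up f)).
    rewrite fsubst_up_fwk in IHprov2. now rewrite map_fwk_fsubst.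
Qed.

(** * Extensional equality and abstraction *)

Definition eqv {G} (H : list (fm G)) {t} (a b : tm G t) : Prop :=
  prov H (eqt a b).

(** The accessibility relation of the Kripke-style arguments. Comparing provable formulas instead of
    lists makes transport of a fact mere application. *)
Definition ext {G} (H H' : list (fm G)) : Prop :=
  forall A, prov H A -> prov H' A.

Lemma ext_eqv G (H H' : list (fm G)) t (a b : tm G t) :
  ext H H' -> eqv H a b -> eqv H' a b.
Proof. intros w; apply w. Qed.

Lemma ext_cons G (H : list (fm G)) A : ext H (A :: H).
Proof. intros B D; apply (prov_weaken D); simpl; auto using incl_tl, incl_refl. Qed.

Lemma prov_wk G (H : list (fm G)) s A :
  prov H A -> prov (map (fwk (s := s)) H) (fwk A).
Proof. intros D; exact (prov_fsubst D (shift s)). Qed.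

Lemma all_open G (H : list (fm G)) s (A : fm (s :: G)) :
  prov H (All s A) -> prov (map fwk H) A.
Proof.
  intros D. rewrite <- (inst_up_shift A).
  apply p_allE. exact (prov_wk s D).
Qed.

Lemma eqv_refl G (H : list (fm G)) t (a : tm G t) : eqv H a a.
Proof.
  revert G H a; induction t as [|s _ t IH]; intros G H a.
  - apply p_ax, ax_refl.
  - apply p_allI, IH.
Qed.

Lemma eqv_sym G (H : list (fm G)) t (a b : tm G t) : eqv H a b -> eqv H b a.
Proof.
  revert G H a b; induction t as [|s _ t IH]; intros G H a b D.
  - eapply p_impE; [apply p_ax, ax_sym | exact D].
  - apply p_allI, IH. exact (all_open D).
Qed.

Lemma eqv_trans G (H : list (fm G)) t (a b c : tm G t) :
  eqv H a b -> eqv H b c -> eqv H a c.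
Proof.
  revert G H a b c; induction t as [|s _ t IH]; intros G H a b c D E.
  - eapply p_impE; [eapply p_impE; [apply p_ax, ax_trans | exact D] | exact E].
  - apply p_allI. eapply IH; [exact (all_open D) | exact (all_open E)].
Qed.

#[export] Instance eqv_equivalence G (H : list (fm G)) t :
  Equivalence (eqv H (t := t)).
Proof.
  split; [exact (@eqv_refl G H t) | exact (@eqv_sym G H t) | exact (@eqv_trans G H t)].
Qed.

Lemma eqv_fun G (H : list (fm G)) s t (f g : tm G (Arr s t)) a :
  eqv H f g -> eqv H (f @ a) (g @ a).
Proof.
  intros D. pose proof (p_allE a D) as E. unfold inst in E.
  rewrite fsubst_eqt in E. simpl in E. now rewrite !tsubst_inst_wk in E.
Qed.

(** Setoid rewriting at all types rests on this: the extensionality axiom changes the argument, the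
    pointwise meaning of equality changes the function. *)
#[export] Instance App_proper G (H : list (fm G)) s t :
  Proper (eqv H ==> eqv H ==> eqv H) (@App G s t).
Proof.
  intros f g D a b E. transitivity (f @ b).
  - eapply p_impE; [apply p_ax, ax_ext | exact E].
  - now apply eqv_fun.
Qed.

(** The quantification over stronger lists makes this a congruence for negation: equivalence at [H]
    alone would say nothing under an additional hypothesis. *)
Definition iffv {G} (H : list (fm G)) (A B : fm G) : Prop :=
  forall H', ext H H' -> (prov H' A <-> prov H' B).

#[export] Instance iffv_equivalence G (H : list (fm G)) : Equivalence (iffv H).
Proof.
  split.
  - intros A H' w; reflexivity.
  - intros A B D H' w; symmetry; now apply D.
  - intros A B C D E H' w; now rewrite (D H' w), (E H' w).
Qed.

#[export] Instance prov_proper G (H : list (fm G)) :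
  Proper (iffv H ==> iff) (prov H).
Proof. intros A B D; apply D; now intros X. Qed.

#[export] Instance Eq_proper G (H : list (fm G)) :
  Proper (eqv H ==> eqv H ==> iffv H) (@Eq G).
Proof.
  intros a b D c d E H' w. apply w in D, E.
  change (eqv H' a b) in D; change (eqv H' c d) in E.
  change (eqv H' a c <-> eqv H' b d). now rewrite D, E.
Qed.

#[export] Instance le_proper G (H : list (fm G)) :
  Proper (eqv H ==> eqv H ==> iffv H) (@le G).
Proof. intros a b D c d E; unfold le, monus; now rewrite D, E. Qed.

#[export] Instance lt_proper G (H : list (fm G)) :
  Proper (eqv H ==> eqv H ==> iffv H) (@lt G).
Proof. intros a b D c d E; unfold lt; now rewrite D, E. Qed.

#[export] Instance add_proper G (H : list (fm G)) :
  Proper (eqv H ==> eqv H ==> eqv H) (@add G).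
Proof. intros a b D c d E; unfold add; now rewrite D, E. Qed.

#[export] Instance pred_proper G (H : list (fm G)) :
  Proper (eqv H ==> eqv H) (@pred G).
Proof. intros a b D; unfold pred; now rewrite D. Qed.

#[export] Instance monus_proper G (H : list (fm G)) :
  Proper (eqv H ==> eqv H ==> eqv H) (@monus G).
Proof. intros a b D c d E; unfold monus; now rewrite D, E. Qed.

#[export] Instance tri_proper G (H : list (fm G)) :
  Proper (eqv H ==> eqv H) (@tri G).
Proof. intros a b D; unfold tri; now rewrite D. Qed.

#[export] Instance edge_proper G (H : list (fm G)) :
  Proper (eqv H ==> eqv H ==> eqv H) (@edge G).
Proof. intros a b D c d E; unfold edge; now rewrite D, E. Qed.

#[export] Instance pair_proper G (H : list (fm G)) :
  Proper (eqv H ==> eqv H ==> eqv H) (@pair G).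
Proof. intros a b D c d E; unfold pair; now rewrite D, E. Qed.

Lemma imp_intro G (H : list (fm G)) A B :
  (forall H', ext H H' -> prov H' A -> prov H' B) -> prov H (Imp A B).
Proof.
  intros D. apply p_impI, D; [apply ext_cons | apply p_hyp; now left].
Qed.

Lemma or_elim G (H : list (fm G)) A B C :
  prov H (Or A B) ->
  (forall H', ext H H' -> prov H' A -> prov H' C) ->
  (forall H', ext H H' -> prov H' B -> prov H' C) -> prov H C.
Proof.
  intros D EA EB. apply (p_orE D).
  - apply EA; [apply ext_cons | apply p_hyp; now left].
  - apply EB; [apply ext_cons | apply p_hyp; now left].
Qed.

Lemma absurd G (H : list (fm G)) A B : prov H (Neg A) -> prov H A -> prov H B.
Proof. intros D E; apply p_botE; exact (p_impE D E). Qed.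

#[export] Instance Neg_proper G (H : list (fm G)) :
  Proper (iffv H ==> iffv H) (@Neg G).
Proof.
  intros A B D H' w; split; intros h; apply imp_intro; intros H'' w' h'.
  all: refine (p_impE (w' _ h) _); apply (D H''); [|exact h'].
  all: intros C d; exact (w' _ (w _ d)).
Qed.

Definition nilsub {G} : sub [] G :=
  fun t (z : var [] t) =>
    match z in var E _ return match E with [] => tm G t | _ => unit end
    with VZ => tt | VS _ => tt end.

Definition cl {G t} (a : tm [] t) : tm G t := tsubst nilsub a.

Lemma var_nil t (x : var [] t) : False.
Proof.
  exact (match x in var E t'
      return match E with [] => False | _ => True end with VZ => I | VS _ => I end).
Qed.

Lemma tsubst_cl G D (f : sub G D) t (a : tm [] t) : tsubst f (cl a) = cl a.
Proof.
  unfold cl; rewrite tsubst_comp; apply tsubst_ext.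
  intros u x; destruct (var_nil x).
Qed.

(** Bracket abstraction does not commute with substitution, hence the explicit
    [f] in the beta rule. *)
Lemma beta_sub s G t (a : tm (s :: G) t) D (f : sub G D) H b :
  eqv H (tsubst f (lam a) @ b) (tsubst (scons b f) a).
Proof.
  assert (pi : forall r u (x : tm D r) (y : tm D u), eqv H (Pi r u @ x @ y) x)
    by (intros; apply p_ax, ax_pi).
  assert (sigma : forall r u v (x : tm D (Arr r (Arr u v))) y z,
    eqv H (Sigma r u v @ x @ y @ z) (x @ z @ (y @ z)))
    by (intros; apply p_ax, ax_sigma).
  induction a as [t x|u t a IHa c IHc| | | | |]; simpl; try apply pi.
  - revert t x; refine (var_case _ _ _); simpl.
    + rewrite sigma; apply pi.
    + intros t y; apply pi.
  - rewrite sigma. now rewrite IHa, IHc.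
Qed.

Lemma beta1 s t (a : tm [s] t) G (H : list (fm G)) x :
  eqv H (cl (lam a) @ x) (tsubst (scons x nilsub) a).
Proof. apply beta_sub. Qed.

Lemma beta2 s r t (a : tm [s; r] t) G (H : list (fm G)) x y :
  eqv H (cl (lam (lam a)) @ x @ y) (tsubst (scons y (scons x nilsub)) a).
Proof. rewrite beta1; apply beta_sub. Qed.

Lemma beta3 s r u t (a : tm [s; r; u] t) G (H : list (fm G)) x y z :
  eqv H (cl (lam (lam (lam a))) @ x @ y @ z)
    (tsubst (scons z (scons y (scons x nilsub))) a).
Proof. rewrite beta2; apply beta_sub. Qed.

Lemma beta4 s r u v t (a : tm [s; r; u; v] t) G (H : list (fm G)) w x y z :
  eqv H (cl (lam (lam (lam (lam a)))) @ w @ x @ y @ z)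
    (tsubst (scons z (scons y (scons x (scons w nilsub)))) a).
Proof. rewrite beta3; apply beta_sub. Qed.

(** * Quantifier-free induction *)

Fixpoint env (G : ctx) (ts : list ty) : Type :=
  match ts with [] => unit | t :: ts => (tm G t * env G ts)%type end.

Fixpoint esubst G D (f : sub G D) ts : env G ts -> env D ts :=
  match ts with
  | [] => fun e => e
  | t :: ts => fun e => (tsubst f (fst e), esubst f ts (snd e))
  end.

(** Induction on a formula [F] with parameters from [e], under a hypothesis [C]
    on these parameters that need not be quantifier-free. Giving [F] and [C]
    uniformly in the context avoids all de Bruijn bookkeeping in applications. *)
Lemma qf_induction_under ts (C : forall G, env G ts -> fm G)
    (F : forall G, tm G N -> env G ts -> fm G) :
  (forall G D (f : sub G D) e, fsubst f (C G e) = C D (esubst f ts e)) ->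
  (forall G n e, qfree (F G n e)) ->
  (forall G D (f : sub G D) n e,
    fsubst f (F G n e) = F D (tsubst f n) (esubst f ts e)) ->
  (forall G H e, prov H (C G e) -> prov H (F G Zero e)) ->
  (forall G H n e, prov H (C G e) -> prov H (F G n e) ->
    prov H (F G (Succ @ n) e)) ->
  forall G H n e, prov H (C G e) -> prov H (F G n e).
Proof.
  intros natC qf natF base step G H n e c.
  (* The induction formula is [F] at the fresh variable with shifted parameters; by naturality its
     instance at any [m] is [F] at [m] again. *)
  set (A := F (N :: G) v0 (esubst (shift N) ts e)).
  assert (eids : forall D (f : sub (N :: G) D) (g : sub G D),
      (forall t x, f _ (VS x) = g t x) ->
      esubst f ts (esubst (shift N) ts e) = esubst g ts e).
  { intros D f g E. clear - E. induction ts as [|t ts IH]; simpl; [reflexivity|].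
    f_equal; [|apply IH].
    rewrite tsubst_comp; apply tsubst_ext; exact E. }
  assert (eid : esubst idsub ts e = e).
  { clear. induction ts as [|t ts IH]; simpl in *; [now destruct e|].
    destruct e; simpl; now rewrite tsubst_id, IH. }
  assert (inst_A : forall m, inst A m = F G m e).
  { intros m; unfold inst, A; rewrite natF; simpl.
    now rewrite (eids _ _ idsub), eid. }
  rewrite <- inst_A. apply p_allE.
  refine (p_impE (p_ax _ (ax_qf_ind A (qf _ _ _))) _).
  apply p_andI.
  - rewrite inst_A; auto.
  - apply p_allI, imp_intro; intros H' w IH.
    unfold A; rewrite natF; simpl. rewrite (eids _ _ (shift N)) by reflexivity.
    apply step; [|exact IH].
    (* The side condition is moved under the quantifier as a known fact and never enters the
       induction formula. *)
    rewrite <- natC. exact (w _ (prov_wk N c)).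
Qed.

Lemma qf_induction ts (F : forall G, tm G N -> env G ts -> fm G) :
  (forall G n e, qfree (F G n e)) ->
  (forall G D (f : sub G D) n e,
    fsubst f (F G n e) = F D (tsubst f n) (esubst f ts e)) ->
  (forall G H e, prov H (F G Zero e)) ->
  (forall G H n e, prov H (F G n e) -> prov H (F G (Succ @ n) e)) ->
  forall G H n e, prov H (F G n e).
Proof.
  intros qf nat base step G H n e.
  refine (qf_induction_under ts (fun _ _ => Eq Zero Zero) F _ qf nat _ _ n e _);
    auto.
  apply p_ax, ax_refl.
Qed.

Lemma tsubst_numeral G D (f : sub G D) n : tsubst f (numeral n) = numeral n.
Proof. induction n; simpl; congruence. Qed.

Lemma tsubst_add G D (f : sub G D) a b :
  tsubst f (add a b) = add (tsubst f a) (tsubst f b).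
Proof. reflexivity. Qed.

Lemma tsubst_monus G D (f : sub G D) a b :
  tsubst f (monus a b) = monus (tsubst f a) (tsubst f b).
Proof. reflexivity. Qed.

Lemma tsubst_edge G D (f : sub G D) a b :
  tsubst f (edge a b) = edge (tsubst f a) (tsubst f b).
Proof. reflexivity. Qed.

Lemma tsubst_pred G D (f : sub G D) a : tsubst f (pred a) = pred (tsubst f a).
Proof. reflexivity. Qed.

Lemma fsubst_le G D (f : sub G D) a b :
  fsubst f (le a b) = le (tsubst f a) (tsubst f b).
Proof. reflexivity. Qed.

Lemma fsubst_lt G D (f : sub G D) a b :
  fsubst f (lt a b) = lt (tsubst f a) (tsubst f b).
Proof. reflexivity. Qed.

Lemma tsubst_pair G D (f : sub G D) a b :
  tsubst f (pair a b) = pair (tsubst f a) (tsubst f b).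
Proof. reflexivity. Qed.

Hint Rewrite fsubst_le fsubst_lt tsubst_edge tsubst_pred tsubst_numeral
  tsubst_add tsubst_monus tsubst_pair tsubst_cl : subst.

Ltac nat_subst :=
  intros; repeat (progress (cbn [fsubst tsubst esubst fst snd];
    autorewrite with subst)); reflexivity.

(** * Arithmetic *)

Ltac norm_eqv :=
  repeat match goal with
  | h : prov ?H (Eq ?a ?b) |- _ => change (eqv H a b) in h
  | |- prov ?H (Eq ?a ?b) => change (eqv H a b)
  | |- prov ?H (eqt ?a ?b) => change (eqv H a b)
  end.

(** Moves all hypotheses along the context extension [w]. *)
Ltac lift w :=
  match type of w with ext ?H ?H' =>
    repeat match goal with
    | h : prov H _ |- _ => apply w in h
    | h : eqv H _ _ |- _ => apply (ext_eqv w) in h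
    end;
    clear w; try clear H; try rename H' into H
  end.

Tactic Notation "imp_i" ident(h) :=
  apply imp_intro; let H' := fresh "H'" in let w := fresh "w" in
  intros H' w h; lift w; norm_eqv.

Tactic Notation "or_e" constr(D) ident(h1) ident(h2) :=
  let H' := fresh "H'" in let w := fresh "w" in
  apply (or_elim D); [intros H' w h1; lift w | intros H' w h2; lift w]; norm_eqv.

Tactic Notation "qind" constr(ts) uconstr(F) constr(a) constr(p) :=
  refine (@qf_induction ts F _ _ _ _ _ _ a p);
  [ intros; cbn; tauto
  | nat_subst
  | clear; intros G H e; cbn in e
  | clear; intros G H n e; cbn in e ].

Lemma add_0l G (H : list (fm G)) b : eqv H (add Zero b) b.
Proof. apply p_ax, ax_rec_zero. Qed.

Lemma add_Sl G (H : list (fm G)) a b :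
  eqv H (add (Succ @ a) b) (Succ @ add a b).
Proof.
  etransitivity; [apply p_ax, ax_rec_succ|].
  exact (beta2 (Succ @ v1) H (add a b) a).
Qed.

Lemma add_0r G (H : list (fm G)) a : eqv H (add a Zero) a.
Proof.
  qind (@nil ty) (fun G n (_ : env G []) => Eq (add n Zero) n) a tt; norm_eqv.
  - apply add_0l.
  - intros IH; norm_eqv. now rewrite add_Sl, IH.
Qed.

Lemma add_Sr G (H : list (fm G)) a b :
  eqv H (add a (Succ @ b)) (Succ @ add a b).
Proof.
  qind [N] (fun G n (e : env G [N]) =>
      Eq (add n (Succ @ fst e)) (Succ @ add n (fst e))) a (b, tt).
  - norm_eqv. now rewrite !add_0l.
  - intros IH; norm_eqv. now rewrite !add_Sl, IH.
Qed.

Lemma add_comm G (H : list (fm G)) a b : eqv H (add a b) (add b a).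
Proof.
  qind [N] (fun G n (e : env G [N]) =>
      Eq (add n (fst e)) (add (fst e) n)) a (b, tt).
  - norm_eqv. now rewrite add_0l, add_0r.
  - intros IH; norm_eqv. now rewrite add_Sl, add_Sr, IH.
Qed.

Lemma add_assoc G (H : list (fm G)) a b c :
  eqv H (add a (add b c)) (add (add a b) c).
Proof.
  qind [N; N] (fun G n (e : env G [N; N]) =>
      let b := fst e in let c := fst (snd e) in
      Eq (add n (add b c)) (add (add n b) c)) a (b, (c, tt)); cbv zeta.
  - norm_eqv. now rewrite !add_0l.
  - intros IH; norm_eqv. now rewrite !add_Sl, IH.
Qed.

Lemma pred_0 G (H : list (fm G)) : eqv H (pred Zero) Zero.
Proof. apply p_ax, ax_rec_zero. Qed.

Lemma pred_S G (H : list (fm G)) a : eqv H (pred (Succ @ a)) a.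
Proof.
  etransitivity; [apply p_ax, ax_rec_succ|]. exact (beta2 v0 H (pred a) a).
Qed.

Lemma monus_0r G (H : list (fm G)) a : eqv H (monus a Zero) a.
Proof. apply p_ax, ax_rec_zero. Qed.

Lemma monus_Sr G (H : list (fm G)) a b :
  eqv H (monus a (Succ @ b)) (pred (monus a b)).
Proof.
  etransitivity; [apply p_ax, ax_rec_succ|].
  exact (beta2 (pred v1) H (monus a b) b).
Qed.

Lemma succ_zero_absurd G (H : list (fm G)) a A :
  eqv H (Succ @ a) Zero -> prov H A.
Proof. intros E. exact (absurd A (p_ax _ (ax_succ_zero a)) E). Qed.

(** The source of case distinctions on numbers in the intuitionistic theory: an induction that
    ignores its hypothesis. *)
Lemma zero_or_succ G (H : list (fm G)) a :
  prov H (Or (Eq a Zero) (Eq a (Succ @ pred a))).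
Proof.
  qind (@nil ty) (fun G n (_ : env G []) =>
    Or (Eq n Zero) (Eq n (Succ @ pred n))) a tt.
  - apply p_orI1, p_ax, ax_refl.
  - intros _. apply p_orI2; norm_eqv. now rewrite pred_S.
Qed.

Lemma nat_case G (H : list (fm G)) a C :
  (forall H', ext H H' -> eqv H' a Zero -> prov H' C) ->
  (forall H' b, ext H H' -> eqv H' a (Succ @ b) -> prov H' C) -> prov H C.
Proof.
  intros D E. apply (or_elim (zero_or_succ H a)); intros H' w h; eauto.
Qed.

Tactic Notation "nat_c" constr(a) ident(b) ident(h) :=
  let H' := fresh "H'" in let w := fresh "w" in
  apply (@nat_case _ _ a); [intros H' w h; lift w | intros H' b w h; lift w];
  norm_eqv.

Lemma monus_0l G (H : list (fm G)) a : eqv H (monus Zero a) Zero.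
Proof.
  qind (@nil ty) (fun G n (_ : env G []) => Eq (monus Zero n) Zero) a tt;
    norm_eqv.
  - apply monus_0r.
  - intros IH; norm_eqv. now rewrite monus_Sr, IH, pred_0.
Qed.

Lemma monus_SS G (H : list (fm G)) a b :
  eqv H (monus (Succ @ a) (Succ @ b)) (monus a b).
Proof.
  qind [N] (fun G n (e : env G [N]) =>
      Eq (monus (Succ @ fst e) (Succ @ n)) (monus (fst e) n)) b (a, tt);
    norm_eqv.
  - now rewrite monus_Sr, !monus_0r, pred_S.
  - intros IH; norm_eqv. now rewrite monus_Sr, IH, monus_Sr.
Qed.

Lemma monus_add G (H : list (fm G)) a b : eqv H (monus (add a b) a) b.
Proof.
  qind [N] (fun G n (e : env G [N]) =>
      Eq (monus (add n (fst e)) n) (fst e)) a (b, tt); norm_eqv.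
  - now rewrite add_0l, monus_0r.
  - intros IH; norm_eqv. now rewrite add_Sl, monus_SS, IH.
Qed.

Lemma monus_diag G (H : list (fm G)) a : eqv H (monus a a) Zero.
Proof. rewrite <- (add_0r H a) at 1. apply monus_add. Qed.

Lemma le_SS G (H : list (fm G)) a b :
  prov H (le (Succ @ a) (Succ @ b)) <-> prov H (le a b).
Proof. unfold le. now rewrite monus_SS. Qed.

Lemma le_0l G (H : list (fm G)) a : prov H (le Zero a).
Proof. apply monus_0l. Qed.

Lemma le_add G (H : list (fm G)) a b : prov H (le a (add a b)).
Proof.
  qind [N] (fun G n (e : env G [N]) => le n (add n (fst e))) a (b, tt).
  - apply le_0l.
  - intros IH. now rewrite add_Sl, le_SS.
Qed.

Lemma le_intro G (H : list (fm G)) a b d : eqv H b (add a d) -> prov H (le a b).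
Proof. intros E. rewrite E; apply le_add. Qed.

Lemma add_monus G (H : list (fm G)) a b :
  prov H (le a b) -> eqv H (add a (monus b a)) b.
Proof.
  apply p_impE.
  qind [N] (fun G n (e : env G [N]) =>
      Imp (le n (fst e)) (Eq (add n (monus (fst e) n)) (fst e))) a (b, tt).
  - imp_i h. now rewrite add_0l, monus_0r.
  - destruct e as [b []]; simpl. intros IH; imp_i h.
    assert (E : eqv H (add n (monus b n)) b).
    { apply (p_impE IH). unfold le. norm_eqv.
      rewrite <- monus_SS, monus_Sr. unfold le in h; norm_eqv.
      now rewrite h, pred_0. }
    rewrite monus_Sr.
    nat_c (monus b n) d hd.
    (* Here [b = n], and (n + 1) - n = 1 contradicts [h]. *)
    + apply (@succ_zero_absurd _ _ Zero).
      rewrite hd, add_0r in E. rewrite <- E in h.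
      unfold le in h; norm_eqv.
      assert (E' : eqv H (Succ @ n) (add n (Succ @ Zero)))
        by now rewrite add_Sr, add_0r.
      now rewrite E', monus_add in h.
    + rewrite hd, pred_S, add_Sl, <- add_Sr. now rewrite hd in E.
Qed.

(** The existential is Rocq's own: truncated subtraction supplies a term as witness. *)
Lemma le_elim G (H : list (fm G)) a b :
  prov H (le a b) -> exists d, eqv H b (add a d).
Proof. intros h. exists (monus b a). now rewrite add_monus. Qed.

Lemma add_inj G (H : list (fm G)) a b c :
  eqv H (add a b) (add a c) -> eqv H b c.
Proof. intros E. now rewrite <- (monus_add H a b), E, monus_add. Qed.

Lemma add_eq0_l G (H : list (fm G)) a b : eqv H (add a b) Zero -> eqv H a Zero.
Proof.
  intros E. pose proof (le_add H a b) as D. rewrite E in D.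
  unfold le in D; norm_eqv. now rewrite monus_0r in D.
Qed.

Lemma add_eq0_r G (H : list (fm G)) a b : eqv H (add a b) Zero -> eqv H b Zero.
Proof. rewrite add_comm. apply add_eq0_l. Qed.

Lemma le_refl G (H : list (fm G)) a : prov H (le a a).
Proof. apply monus_diag. Qed.

Lemma le_trans G (H : list (fm G)) a b c :
  prov H (le a b) -> prov H (le b c) -> prov H (le a c).
Proof.
  intros h1 h2. destruct (le_elim h1) as [d E], (le_elim h2) as [d' E'].
  rewrite E', E, <- add_assoc. apply le_add.
Qed.

Lemma le_S G (H : list (fm G)) a : prov H (le a (Succ @ a)).
Proof.
  apply (@le_intro _ _ _ _ (Succ @ Zero)). now rewrite add_Sr, add_0r.
Qed.

Lemma lt_le G (H : list (fm G)) a b : prov H (lt a b) -> prov H (le a b).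
Proof. apply le_trans, le_S. Qed.

Lemma le_antisym G (H : list (fm G)) a b :
  prov H (le a b) -> prov H (le b a) -> eqv H a b.
Proof.
  intros h1 h2. destruct (le_elim h1) as [d E], (le_elim h2) as [d' E'].
  rewrite E, <- add_assoc in E'. rewrite <- (add_0r H a) in E' at 1.
  apply add_inj in E'. symmetry in E'. apply add_eq0_l in E'.
  now rewrite E, E', add_0r.
Qed.

Lemma le_0r G (H : list (fm G)) a : prov H (le a Zero) -> eqv H a Zero.
Proof. intros h; apply le_antisym; [exact h | apply le_0l]. Qed.

Lemma lt_irrefl G (H : list (fm G)) a A : prov H (lt a a) -> prov H A.
Proof.
  intros h. destruct (le_elim h) as [d E].
  rewrite add_Sl, <- add_Sr in E. rewrite <- (add_0r H a) in E at 1.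
  apply add_inj in E. symmetry in E. exact (succ_zero_absurd A E).
Qed.

Lemma lt_0r G (H : list (fm G)) a A : prov H (lt a Zero) -> prov H A.
Proof. intros h. exact (succ_zero_absurd A (le_0r h)). Qed.

Lemma lt_0S G (H : list (fm G)) a : prov H (lt Zero (Succ @ a)).
Proof. apply le_SS, le_0l. Qed.

Lemma le_total G (H : list (fm G)) a b : prov H (Or (le a b) (lt b a)).
Proof.
  qind [N] (fun G n (e : env G [N]) => Or (le n (fst e)) (lt (fst e) n))
    a (b, tt); destruct e as [b []]; simpl.
  - apply p_orI1, le_0l.
  - intros IH; or_e IH h h.
    + destruct (le_elim h) as [d E]. nat_c d d' hd.
      * apply p_orI2, le_SS. rewrite E, hd, add_0r. apply le_refl.
      * apply p_orI1. rewrite E, hd, add_Sr, le_SS. apply le_add.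
    + apply p_orI2. exact (le_trans h (le_S _ _)).
Qed.

Lemma le_lt_absurd G (H : list (fm G)) a b A :
  prov H (le a b) -> prov H (lt b a) -> prov H A.
Proof. intros h1 h2. exact (lt_irrefl _ (le_trans h2 h1)). Qed.

Lemma le_cases G (H : list (fm G)) a b :
  prov H (le a b) -> prov H (Or (Eq a b) (lt a b)).
Proof.
  intros h. or_e (le_total H b a) h' h'.
  - apply p_orI1. now apply le_antisym.
  - now apply p_orI2.
Qed.

Lemma pos_elim G (H : list (fm G)) a :
  prov H (lt Zero a) -> eqv H a (Succ @ pred a).
Proof.
  intros h. or_e (zero_or_succ H a) h' h'; [|exact h'].
  rewrite h' in h. exact (lt_irrefl _ h).
Qed.

(** Proof by contradiction is sound here because equality with zero is decidable. *)
Lemma neq_0_pos G (H : list (fm G)) a :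
  (forall H', ext H H' -> eqv H' a Zero -> prov H' Bot) -> prov H (lt Zero a).
Proof.
  intros D. apply (@nat_case _ _ a).
  - intros H' w h. apply p_botE, D; auto.
  - intros H' b w h. rewrite h. apply lt_0S.
Qed.

Lemma add_le_mono G (H : list (fm G)) a a' b b' :
  prov H (le a a') -> prov H (le b b') -> prov H (le (add a b) (add a' b')).
Proof.
  intros h1 h2. destruct (le_elim h1) as [d E], (le_elim h2) as [d' E'].
  apply (@le_intro _ _ _ _ (add d d')).
  rewrite E, E', <- !add_assoc, (add_assoc H b d), (add_comm H b d).
  now rewrite <- !add_assoc.
Qed.

Lemma le_add_r G (H : list (fm G)) a b : prov H (le a (add b a)).
Proof. rewrite add_comm; apply le_add. Qed.

Lemma monus_S_l G (H : list (fm G)) a b :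
  prov H (le b a) -> eqv H (monus (Succ @ a) b) (Succ @ monus a b).
Proof.
  intros h. destruct (le_elim h) as [d E].
  now rewrite E, <- add_Sr, !monus_add.
Qed.

Lemma monus_S_monus G (H : list (fm G)) a b :
  prov H (le b a) -> eqv H (monus (Succ @ a) (monus a b)) (Succ @ b).
Proof.
  intros h. destruct (le_elim h) as [d E].
  now rewrite E, monus_add, add_comm, <- add_Sr, monus_add.
Qed.

Lemma monus_add_monus G (H : list (fm G)) a b c :
  prov H (le c b) -> prov H (le b a) ->
  eqv H (add (monus b c) (monus a b)) (monus a c).
Proof.
  intros h1 h2. destruct (le_elim h1) as [d E], (le_elim h2) as [d' E'].
  rewrite E', monus_add, E, <- add_assoc, !monus_add. reflexivity.
Qed.

Lemma monus_pos G (H : list (fm G)) a b :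
  prov H (lt Zero (monus a b)) -> prov H (lt b a).
Proof.
  intros h. or_e (le_total H a b) h' h'; [|exact h'].
  unfold le in h'; norm_eqv. rewrite h' in h. exact (lt_irrefl _ h).
Qed.

(** [b] if [a = 0], else [c]. *)
Definition ite {G} (a b c : tm G N) : tm G N :=
  Rec @ a @ b @ (Pi _ _ @ (Pi _ _ @ c)).

#[export] Instance ite_proper G (H : list (fm G)) :
  Proper (eqv H ==> eqv H ==> eqv H ==> eqv H) (@ite G).
Proof. intros a b D c d E f g F; unfold ite; now rewrite D, E, F. Qed.

Lemma tsubst_ite G D (f : sub G D) a b c :
  tsubst f (ite a b c) = ite (tsubst f a) (tsubst f b) (tsubst f c).
Proof. reflexivity. Qed.

Hint Rewrite tsubst_ite : subst.

Lemma ite_0 G (H : list (fm G)) b c : eqv H (ite Zero b c) b.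
Proof. apply p_ax, ax_rec_zero. Qed.

Lemma ite_S G (H : list (fm G)) a b c : eqv H (ite (Succ @ a) b c) c.
Proof.
  etransitivity; [apply p_ax, ax_rec_succ|].
  transitivity (Pi _ N @ c @ a); [apply App_proper; [|reflexivity] |];
    apply p_ax, ax_pi.
Qed.

(** [search g n] is [0] if [g] has no zero below [n], and otherwise the
    successor of its least zero. *)
Definition search_step : tm [] (Arr one (Arr N (Arr N N))) :=
  lam (lam (lam (ite v1 (ite (v2 @ v0) (Succ @ v0) Zero) v1))).

Definition search {G} (g : tm G one) (n : tm G N) : tm G N :=
  Rec @ n @ Zero @ (cl search_step @ g).

#[export] Instance search_proper G (H : list (fm G)) :
  Proper (eqv H ==> eqv H ==> eqv H) (@search G).
Proof. intros a b D c d E; unfold search; now rewrite D, E. Qed.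

Lemma tsubst_search G D (f : sub G D) g n :
  tsubst f (search g n) = search (tsubst f g) (tsubst f n).
Proof. unfold search; cbn [tsubst]; now rewrite tsubst_cl. Qed.

Hint Rewrite tsubst_search : subst.

Lemma search_0 G (H : list (fm G)) g : eqv H (search g Zero) Zero.
Proof. apply p_ax, ax_rec_zero. Qed.

Lemma search_S G (H : list (fm G)) g n :
  eqv H (search g (Succ @ n))
    (ite (search g n) (ite (g @ n) (Succ @ n) Zero) (search g n)).
Proof.
  etransitivity; [apply p_ax, ax_rec_succ|].
  exact (beta3 (ite v1 (ite (v2 @ v0) (Succ @ v0) Zero) v1) H g (search g n) n).
Qed.

Lemma search_sound G (H : list (fm G)) g n :
  prov H (Or (Eq (search g n) Zero)
    (And (Eq (g @ pred (search g n)) Zero)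
         (And (lt Zero (search g n)) (le (search g n) n)))).
Proof.
  qind [one] (fun G n (e : env G [one]) => let g := fst e in
    Or (Eq (search g n) Zero)
    (And (Eq (g @ pred (search g n)) Zero)
         (And (lt Zero (search g n)) (le (search g n) n)))) n (g, tt);
    destruct e as [g []]; simpl.
  - apply p_orI1, search_0.
  - intros IH; or_e IH h h.
    + nat_c (g @ n) d hd.
      * apply p_orI2; repeat apply p_andI; norm_eqv;
          rewrite search_S, h, ite_0, hd, ite_0.
        -- now rewrite pred_S.
        -- apply lt_0S.
        -- apply le_refl.
      * apply p_orI1; norm_eqv. now rewrite search_S, h, ite_0, hd, ite_S.
    + apply p_orI2.
      pose proof (p_andE1 h) as h1; norm_eqv.
      pose proof (p_andE1 (p_andE2 h)) as h2.
      pose proof (p_andE2 (p_andE2 h)) as h3.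
      assert (E : eqv H (search g (Succ @ n)) (search g n))
        by now rewrite search_S, (pos_elim h2), ite_S.
      repeat apply p_andI; norm_eqv; rewrite E; auto.
      exact (le_trans h3 (le_S _ _)).
Qed.

Lemma search_complete G (H : list (fm G)) g n t :
  prov H (lt t n) -> eqv H (search g n) Zero -> prov H (lt Zero (g @ t)).
Proof.
  intros h1 h2; revert h2; apply p_impE; revert h1; apply p_impE.
  qind [one; N] (fun G n (e : env G [one; N]) =>
    let g := fst e in let t := fst (snd e) in
    Imp (lt t n) (Imp (Eq (search g n) Zero) (lt Zero (g @ t)))) n (g, (t, tt));
    destruct e as [g [t []]]; simpl.
  - imp_i h; apply p_botE, (lt_0r _ h).
  - intros IH; imp_i h1; imp_i h2.
    rewrite search_S in h2. nat_c (search g n) d hd.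
    + rewrite hd, ite_0 in h2. apply -> le_SS in h1.
      or_e (le_cases h1) h h.
      * rewrite h. nat_c (g @ n) d' hd'.
        -- rewrite hd', ite_0 in h2. exact (succ_zero_absurd _ h2).
        -- rewrite hd'. apply lt_0S.
      * exact (p_impE (p_impE IH h) hd).
    + rewrite hd, ite_S in h2. exact (succ_zero_absurd _ h2).
Qed.

Lemma search_minimal G (H : list (fm G)) g n t :
  prov H (lt t (pred (search g n))) -> prov H (lt Zero (g @ t)).
Proof.
  apply p_impE.
  qind [one; N] (fun G n (e : env G [one; N]) =>
    let g := fst e in let t := fst (snd e) in
    Imp (lt t (pred (search g n))) (lt Zero (g @ t))) n (g, (t, tt));
    destruct e as [g [t []]]; simpl.
  - imp_i h. rewrite search_0, pred_0 in h. exact (lt_0r _ h).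
  - intros IH; imp_i h. rewrite search_S in h. nat_c (search g n) d hd.
    + rewrite hd, ite_0 in h. nat_c (g @ n) d' hd'.
      * rewrite hd', ite_0, pred_S in h. exact (search_complete h hd).
      * rewrite hd', ite_S, pred_0 in h. exact (lt_0r _ h).
    + apply (p_impE IH). now rewrite hd, ite_S, <- hd in h.
Qed.

Lemma search_pos G (H : list (fm G)) g n t :
  prov H (lt t n) -> eqv H (g @ t) Zero -> prov H (lt Zero (search g n)).
Proof.
  intros h1 h2. apply neq_0_pos; intros H' w h; lift w.
  pose proof (search_complete h1 h) as h3. rewrite h2 in h3.
  exact (lt_irrefl _ h3).
Qed.

(** * Triangular numbers and monotonicity of the codes *)

Lemma tri_0 G (H : list (fm G)) : eqv H (tri Zero) Zero.
Proof. apply p_ax, ax_rec_zero. Qed.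

Lemma tri_S G (H : list (fm G)) n : eqv H (tri (Succ @ n)) (add (tri n) n).
Proof.
  etransitivity; [apply p_ax, ax_rec_succ|].
  exact (beta2 (add v1 v0) H (tri n) n).
Qed.

Lemma tri_mono G (H : list (fm G)) a b :
  prov H (le a b) -> prov H (le (tri a) (tri b)).
Proof.
  intros h; destruct (le_elim h) as [d E]. rewrite E, add_comm. clear.
  qind [N] (fun G n (e : env G [N]) => le (tri (fst e)) (tri (add n (fst e))))
    d (a, tt); destruct e as [a []]; simpl.
  - rewrite add_0l. apply le_refl.
  - intros IH. rewrite add_Sl, tri_S. exact (le_trans IH (le_add _ _ _)).
Qed.

Lemma edge_mono G (H : list (fm G)) a b a' b' :
  prov H (le a a') -> prov H (le b b') -> prov H (le (edge a b) (edge a' b')).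
Proof. intros h1 h2; apply add_le_mono; [apply tri_mono|]; assumption. Qed.

Lemma le_edge G (H : list (fm G)) a b : prov H (le a (edge a b)).
Proof. apply le_add_r. Qed.

Lemma pair_mono G (H : list (fm G)) a b a' b' :
  prov H (le a a') -> prov H (le b b') -> prov H (le (pair a b) (pair a' b')).
Proof. intros h1 h2; apply edge_mono, le_SS, add_le_mono; assumption. Qed.

Lemma le_pair_l G (H : list (fm G)) a b : prov H (le a (pair a b)).
Proof. apply le_add_r. Qed.

Lemma le_pair_r G (H : list (fm G)) a b : prov H (le b (pair a b)).
Proof.
  unfold pair, edge. rewrite tri_S.
  eapply le_trans; [|apply le_add].
  eapply le_trans; [|apply le_add_r]. apply le_add_r.
Qed.

(** * Rules for colorings and LPO *)

(** The analogue of [ext] along a change of variables, for arguments that go under quantifiers. *)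
Definition mor G D (f : sub G D) (H : list (fm G)) (H' : list (fm D)) : Prop :=
  forall A, prov H A -> prov H' (fsubst f A).

Definition shift2 {G s t} : sub G (s :: t :: G) := fun _ x => Var (VS (VS x)).

Lemma tsubst_shift2 G s t u (a : tm G u) :
  tsubst (@shift2 G s t) a = wk (wk a).
Proof. unfold wk; rewrite tsubst_comp; now apply tsubst_ext. Qed.

Lemma mor_all G (H : list (fm G)) s A :
  (forall H', mor (shift s) H H' -> prov H' A) -> prov H (All s A).
Proof. intros D; apply p_allI, D. intros B; apply prov_wk. Qed.

Lemma mor_all2 G (H : list (fm G)) s t A :
  (forall H', mor shift2 H H' -> prov H' A) -> prov H (All s (All t A)).
Proof.
  intros D; apply p_allI, p_allI, D. intros B E.
  replace (fsubst shift2 B) with (fwk (s := t) (fwk (s := s) B))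
    by (unfold fwk; now rewrite fsubst_comp).
  now apply prov_wk, prov_wk.
Qed.

Lemma mor_ext G D (f : sub G D) H H' H'' :
  mor f H H' -> ext H' H'' -> mor f H H''.
Proof. intros m w A E; apply w, m, E. Qed.

Lemma mor_eqv G D (f : sub G D) H H' t (a b : tm G t) :
  mor f H H' -> eqv H a b -> eqv H' (tsubst f a) (tsubst f b).
Proof. intros m E; unfold eqv; rewrite <- fsubst_eqt; now apply m. Qed.

Lemma fsubst_holds P G D (f : sub G D) x y :
  fsubst f (holds P x y) = holds P (tsubst f x) (tsubst f y).
Proof.
  unfold holds; rewrite fsubst_comp; apply fsubst_ext.
  refine (var_case _ _ _); [reflexivity|].
  refine (var_case _ _ _); [reflexivity|].
  intros t z; destruct (var_nil z).
Qed.

Lemma up_VS G D s (f : sub G D) t (x : var G t) :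
  up (s := s) f (VS x) = wk (f t x).
Proof. reflexivity. Qed.

Lemma up_VZ G D s (f : sub G D) : up (s := s) f VZ = v0.
Proof. reflexivity. Qed.

Ltac subst_norm :=
  unfold inst, Neg;
  repeat (progress (cbn [fsubst tsubst scons];
    rewrite ?fsubst_le, ?fsubst_lt, ?tsubst_edge, ?tsubst_pred, ?tsubst_numeral,
      ?up_VS, ?up_VZ, ?tsubst_up_wk, ?tsubst_inst_wk, ?tsubst_shift2)).

Lemma fsubst_coloring k G D (f : sub G D) e c :
  fsubst f (coloring k e c) = coloring k (tsubst f e) (tsubst f c).
Proof. unfold coloring. subst_norm. reflexivity. Qed.

Lemma fsubst_coloring_upto k G D (f : sub G D) e m c :
  fsubst f (coloring_upto k e m c) =
  coloring_upto k (tsubst f e) (tsubst f m) (tsubst f c).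
Proof. unfold coloring_upto. subst_norm. reflexivity. Qed.

Lemma holds_TGC k G (e f : tm G one) :
  holds (TGC k) e f =
  And (Imp (Eq (f @ Zero) Zero) (coloring k e f))
      (Imp (lt Zero (f @ Zero))
           (Neg (Ex one (coloring_upto k (wk e) (wk f @ Zero) v0)))).
Proof.
  unfold holds, TGC. cbn [fsubst]. unfold Neg; cbn [fsubst].
  now rewrite fsubst_coloring, fsubst_coloring_upto.
Qed.

Lemma coloring_lt k G (H : list (fm G)) e f a :
  prov H (coloring k e f) -> prov H (lt (f @ a) (numeral k)).
Proof.
  intros h. pose proof (p_allE a (p_andE1 h)) as h'. revert h'. subst_norm; trivial.
Qed.

Lemma coloring_neq k G (H : list (fm G)) e f a b :
  prov H (coloring k e f) -> prov H (lt a b) ->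
  prov H (lt Zero (e @ edge a b)) -> eqv H (f @ a) (f @ b) -> prov H Bot.
Proof.
  intros h h1 h2 h3. pose proof (p_allE b (p_allE a (p_andE2 h))) as h'. revert h'.
  subst_norm. intros h'. exact (p_impE (p_impE (p_impE h' h1) h2) h3).
Qed.

(** The arbitrary substitution [s] hides that the two clauses lie under one and two binders. *)
Lemma coloring_intro k G (H : list (fm G)) e f :
  (forall D (s : sub G D) H', mor s H H' -> forall a,
    prov H' (lt (tsubst s f @ a) (numeral k))) ->
  (forall D (s : sub G D) H', mor s H H' -> forall a b, prov H' (lt a b) ->
    prov H' (lt Zero (tsubst s e @ edge a b)) ->
    eqv H' (tsubst s f @ a) (tsubst s f @ b) -> prov H' Bot) ->
  prov H (coloring k e f).
Proof.
  intros D E. apply p_andI.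
  - apply mor_all; intros H' m. exact (D _ _ _ m v0).
  - apply mor_all2; intros H' m.
    apply imp_intro; intros H1 w1 h1; apply imp_intro; intros H2 w2 h2;
    apply imp_intro; intros H3 w3 h3.
    specialize (E _ _ H3 (mor_ext (mor_ext (mor_ext m w1) w2) w3) v1 v0).
    rewrite !tsubst_shift2 in E; apply E; auto.
Qed.

Lemma coloring_upto_lt k G (H : list (fm G)) e m f a :
  prov H (coloring_upto k e m f) -> prov H (le a m) ->
  prov H (lt (f @ a) (numeral k)).
Proof.
  intros h h1. pose proof (p_allE a (p_andE1 h)) as h'. revert h'.
  subst_norm. intros h'. exact (p_impE h' h1).
Qed.

Lemma coloring_upto_neq k G (H : list (fm G)) e m f a b :
  prov H (coloring_upto k e m f) -> prov H (lt a b) -> prov H (le b m) ->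
  prov H (lt Zero (e @ edge a b)) -> eqv H (f @ a) (f @ b) -> prov H Bot.
Proof.
  intros h h1 h2 h3 h4.
  pose proof (p_allE b (p_allE a (p_andE2 h))) as h'. revert h'. subst_norm.
  intros h'. refine (p_impE (p_impE (p_impE (p_impE (p_impE h' _) h2) h1) h3) h4).
  exact (le_trans (lt_le h1) h2).
Qed.

Lemma coloring_upto_intro k G (H : list (fm G)) e m f :
  (forall D (s : sub G D) H', mor s H H' -> forall a,
    prov H' (le a (tsubst s m)) -> prov H' (lt (tsubst s f @ a) (numeral k))) ->
  (forall D (s : sub G D) H', mor s H H' -> forall a b, prov H' (lt a b) ->
    prov H' (le b (tsubst s m)) ->
    prov H' (lt Zero (tsubst s e @ edge a b)) ->
    eqv H' (tsubst s f @ a) (tsubst s f @ b) -> prov H' Bot) ->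
  prov H (coloring_upto k e m f).
Proof.
  intros D E. apply p_andI.
  - apply mor_all; intros H' mm. apply imp_intro; intros H1 w1 h1.
    exact (D _ _ _ (mor_ext mm w1) v0 h1).
  - apply mor_all2; intros H' mm.
    apply imp_intro; intros H1 w1 h1; apply imp_intro; intros H2 w2 h2;
    apply imp_intro; intros H3 w3 h3; apply imp_intro; intros H4 w4 h4;
    apply imp_intro; intros H5 w5 h5.
    specialize (E _ _ H5 (mor_ext (mor_ext (mor_ext (mor_ext (mor_ext mm w1) w2)
      w3) w4) w5) v1 v0).
    rewrite !tsubst_shift2 in E; apply E; auto.
Qed.

Lemma holds_LPO G (p y : tm G one) : holds LPO p y = lpo p (y @ Zero).
Proof. reflexivity. Qed.

Lemma fsubst_lpo G D (f : sub G D) p n :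
  fsubst f (lpo p n) = lpo (tsubst f p) (tsubst f n).
Proof. unfold lpo. subst_norm. reflexivity. Qed.

Lemma lpo_pos G (H : list (fm G)) p n a :
  prov H (lpo p n) -> eqv H n Zero -> prov H (lt Zero (p @ a)).
Proof.
  intros h h1. pose proof (p_allE a (p_impE (p_andE1 h) h1)) as h'.
  revert h'. subst_norm. intros h'. exact h'.
Qed.

Lemma lpo_zero G (H : list (fm G)) p n :
  prov H (lpo p n) -> prov H (lt Zero n) -> eqv H (p @ pred n) Zero.
Proof. intros h h1. exact (p_andE1 (p_impE (p_andE2 h) h1)). Qed.

Lemma lpo_intro G (H : list (fm G)) p n :
  (forall D (s : sub G D) H', mor s H H' -> forall a,
    eqv H' (tsubst s n) Zero -> prov H' (lt Zero (tsubst s p @ a))) ->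
  (forall H', ext H H' -> prov H' (lt Zero n) -> eqv H' (p @ pred n) Zero) ->
  (forall D (s : sub G D) H', mor s H H' -> forall a,
    prov H' (lt a (pred (tsubst s n))) -> prov H' (lt Zero (tsubst s p @ a))) ->
  prov H (lpo p n).
Proof.
  intros D E F. apply p_andI; apply imp_intro; intros H' w h.
  - apply mor_all; intros H'' m. refine (D _ _ H'' _ v0 (m _ h)).
    intros A; exact (fun d => m _ (w _ d)).
  - apply p_andI; [exact (E _ w h)|].
    apply mor_all; intros H'' m. apply imp_intro; intros H3 w3 h3.
    refine (F _ _ H3 _ v0 h3). intros A d. exact (w3 _ (m _ (w _ d))).
Qed.

(** * Pigeonhole principle for a standard number of colors *)

Fixpoint one_of {G} (l : list (tm G N)) (x : tm G N) : fm G :=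
  match l with [] => Bot | c :: l => Or (Eq x c) (one_of l x) end.

Lemma one_of_remove G (H : list (fm G)) l l' c x :
  prov H (one_of (l ++ c :: l') x) -> prov H (Neg (Eq x c)) ->
  prov H (one_of (l ++ l') x).
Proof.
  revert H; induction l as [|d l IH]; intros H h h'; simpl in *.
  - or_e h h1 h1; [|exact h1]. exact (absurd _ h' h1).
  - or_e h h1 h1; [now apply p_orI1 | now apply p_orI2, IH].
Qed.

Lemma one_of_elim G (H : list (fm G)) l x A :
  prov H (one_of l x) ->
  (forall H' l1 c l2, ext H H' -> l = l1 ++ c :: l2 -> eqv H' x c -> prov H' A) ->
  prov H A.
Proof.
  intros h D. cut (forall l' l1 H', ext H H' -> l = l1 ++ l' ->
    prov H' (one_of l' x) -> prov H' A).
  { intros E. apply (E l [] H); auto. now intros X. }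
  clear h. induction l' as [|c l' IH]; simpl; intros l1 H' w e h.
  - now apply p_botE.
  - apply (or_elim h); intros H'' w' h'.
    + refine (D H'' l1 c l' _ e h'). intros X d; exact (w' _ (w _ d)).
    + apply (IH (l1 ++ [c]) H''); auto.
      * intros X d; exact (w' _ (w _ d)).
      * now rewrite <- app_assoc.
Qed.

(** Remove the value taken by the first pigeon from the list of holes. *)
Lemma pigeonhole G (f : nat -> tm G N) (is : list nat) : forall H holes,
  length holes < length is -> NoDup is ->
  (forall i, In i is -> prov H (one_of holes (f i))) ->
  (forall i j, In i is -> In j is -> i <> j -> prov H (Neg (Eq (f i) (f j)))) ->
  prov H Bot.
Proof.
  induction is as [|i is IH]; simpl; intros H holes L ND D E; [lia|].
  refine (one_of_elim (D i (or_introl eq_refl)) _).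
  intros H' l1 c l2 w -> h. rewrite length_app in L; simpl in L.
  inversion ND as [|? ? ni ND']; subst.
  apply (IH H' (l1 ++ l2)); auto.
  - rewrite length_app; lia.
  - intros j hj. apply (one_of_remove l1 l2 (c := c)); [apply w, D; auto|].
    rewrite <- h. apply w, E; auto. intros ->; auto.
Qed.

(** The bound is a numeral of the metatheory, so it unfolds into a finite disjunction. *)
Lemma lt_numeral G (H : list (fm G)) k a :
  prov H (lt a (numeral k)) -> prov H (one_of (map numeral (seq 0 k)) a).
Proof.
  cut (forall j n (H : list (fm G)) a, prov H (le (numeral n) a) ->
    prov H (lt a (numeral (j + n))) -> prov H (one_of (map numeral (seq n j)) a)).
  { intros D h. apply (D k 0); [apply le_0l | now rewrite PeanoNat.Nat.add_0_r]. }
  clear. induction j as [|j IH]; simpl; intros n H a h1 h2.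
  - exact (le_lt_absurd _ h1 h2).
  - or_e (le_cases h1) h h.
    + apply p_orI1; norm_eqv; now symmetry.
    + apply p_orI2, IH; [exact h|]. now rewrite PeanoNat.Nat.add_succ_r.
Qed.

(** * From LPO to colorings *)

(** An edge is present iff [p] has a zero below the number of the edge; comparing
    with this number rather than with an endpoint avoids decoding it. *)
Definition lpo_graph : tm [] (Arr one one) := lam (lam (search v1 v0)).

(** If [y @ Zero] is a number m > 0, all edges of the subgraph on {0, ..., m} have codes up to
    [edge m m] by monotonicity, so a zero of [p] that creates one of them is found below this bound.
    The result of [search] already has the format of an LPO answer. *)
Definition lpo_answer : tm [] (Arr one (Arr one one)) :=
  lam (lam (lam (search v2 (edge (v1 @ Zero) (v1 @ Zero))))).

Lemma lpo_graph_eq G (H : list (fm G)) p n :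
  eqv H (cl lpo_graph @ p @ n) (search p n).
Proof. exact (beta2 (search v1 v0) H p n). Qed.

Lemma lpo_answer_eq G (H : list (fm G)) p y n :
  eqv H (cl lpo_answer @ p @ y @ n) (search p (edge (y @ Zero) (y @ Zero))).
Proof.
  exact (beta3 (search v2 (edge (v1 @ Zero) (v1 @ Zero))) H p y n).
Qed.

Lemma lpo_graph_edge G (H : list (fm G)) p j a b :
  eqv H (p @ j) Zero -> prov H (lt j a) ->
  prov H (lt Zero (cl lpo_graph @ p @ edge a b)).
Proof.
  intros h h1. rewrite lpo_graph_eq. apply search_pos with j; [|exact h].
  exact (le_trans h1 (le_edge _ _ _)).
Qed.

Lemma lpo_graph_empty G (H : list (fm G)) p m a b A :
  eqv H (search p (edge m m)) Zero -> prov H (lt a b) -> prov H (le b m) ->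
  prov H (lt Zero (cl lpo_graph @ p @ edge a b)) -> prov H A.
Proof.
  intros h h1 h2 h3. rewrite lpo_graph_eq in h3.
  or_e (search_sound H p (edge a b)) h4 h4.
  - rewrite h4 in h3. exact (lt_irrefl _ h3).
  - pose proof (p_andE1 h4) as h5; norm_eqv.
    pose proof (p_andE2 (p_andE2 h4)) as h6. rewrite (pos_elim h3) in h6.
    assert (h7 : prov H (lt Zero (search p (edge m m)))).
    { refine (search_pos _ h5). refine (le_trans h6 _).
      apply edge_mono; [exact (le_trans (lt_le h1) h2) | exact h2]. }
    rewrite h in h7. exact (lt_irrefl _ h7).
Qed.

Lemma lpo_graph_clique k G (H : list (fm G)) p f j :
  prov H (coloring k (cl lpo_graph @ p) f) -> eqv H (p @ j) Zero -> prov H Bot.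
Proof.
  intros h h1.
  (* The vertices j + 1, ..., j + k + 1 are pairwise adjacent, since the code of an edge is at least
     its smaller endpoint. *)
  set (v := fun i => add (numeral i) (Succ @ j)).
  assert (vj : forall (H : list (fm G)) i, prov H (lt j (v i))) by (intros; apply le_add_r).
  assert (vlt : forall (H : list (fm G)) i d, prov H (lt (v i) (v (S d + i)))).
  { intros H' i d; unfold v; simpl. rewrite add_Sl. apply le_SS.
    induction d; simpl; [apply le_refl|]. rewrite add_Sl.
    exact (le_trans IHd (le_S _ _)). }
  assert (neq : forall i i', i < i' ->
    prov H (Neg (Eq (f @ v i) (f @ v i')))).
  { intros i i' L. replace i' with (S (i' - S i) + i) by lia.
    imp_i h2. refine (coloring_neq h _ _ h2).
    - apply vlt.
    - exact (lpo_graph_edge _ h1 (vj _ i)). }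
  apply (@pigeonhole _ (fun i => f @ v i) (seq 0 (S k)) H
           (map numeral (seq 0 k))).
  - rewrite length_map, !length_seq; lia.
  - apply seq_NoDup.
  - intros i _. apply lt_numeral. exact (coloring_lt _ h).
  - intros i i' _ _ n. destruct (PeanoNat.Nat.lt_total i i') as [l|[e|l]].
    + now apply neq.
    + contradiction.
    + pose proof (neq _ _ l) as h2. imp_i h3. apply (p_impE h2).
      norm_eqv; now symmetry.
Qed.

(** Suppose [p] vanishes at [j]. If [y] announces a coloring, the clique beyond [j] refutes it. If
    [y] announces an uncolorable subgraph, the failed search shows that this subgraph has no edges,
    and the constant 0 colors it, as [1 <= k]. *)
Lemma lpo_answer_sound k G (H : list (fm G)) p y j :
  1 <= k -> prov H (holds (TGC k) (cl lpo_graph @ p) y) ->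
  eqv H (search p (edge (y @ Zero) (y @ Zero))) Zero ->
  prov H (lt Zero (p @ j)).
Proof.
  intros K h h1. rewrite holds_TGC in h.
  apply neq_0_pos; intros H' w h2; lift w.
  or_e (zero_or_succ H (y @ Zero)) h3 h3.
  - exact (lpo_graph_clique (p_impE (p_andE1 h) h3) h2).
  - refine (p_impE (p_impE (p_andE2 h) _) _).
    + rewrite h3; apply lt_0S.
    + apply (@p_exI _ _ _ _ (Pi N N @ Zero)).
      unfold inst; rewrite fsubst_coloring_upto; cbn [tsubst scons].
      rewrite !tsubst_inst_wk.
      assert (cst : forall D (H' : list (fm D)) a, eqv H' (Pi N N @ Zero @ a) Zero)
        by (intros; apply p_ax, ax_pi).
      apply coloring_upto_intro; intros D s H' m; cbn [tsubst].
      * intros a _. rewrite cst. destruct k; [lia | apply lt_0S].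
      * intros a b l1 l2 l3 _. rewrite tsubst_cl in l3.
        exact (lpo_graph_empty _ (mor_eqv m h1) l1 l2 l3).
Qed.

Lemma lpo_answer_correct k G (H : list (fm G)) p y :
  1 <= k -> prov H (holds (TGC k) (cl lpo_graph @ p) y) ->
  prov H (holds LPO p (cl lpo_answer @ p @ y)).
Proof.
  intros K h. rewrite holds_LPO. apply lpo_intro.
  - intros D s H' m a h1. cbn [tsubst] in h1.
    rewrite tsubst_cl, lpo_answer_eq in h1.
    refine (lpo_answer_sound _ K _ h1).
    specialize (m _ h). rewrite fsubst_holds in m. cbn [tsubst] in m.
    now rewrite tsubst_cl in m.
  - intros H' w h1. rewrite lpo_answer_eq in *.
    or_e (search_sound H' p (edge (y @ Zero) (y @ Zero))) h2 h2.
    + rewrite h2 in h1. exact (lt_irrefl _ h1).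
    + exact (p_andE1 h2).
  - intros D s H' m a h1. cbn [tsubst] in h1.
    rewrite tsubst_cl, lpo_answer_eq in h1. exact (search_minimal h1).
Qed.

Lemma wle_LPO_TGC k : 1 <= k -> prov [] (wle LPO (TGC k)).
Proof.
  intros K. unfold wle; cbv zeta.
  apply p_exI with (cl lpo_graph). unfold inst; cbn [fsubst].
  apply p_exI with (cl lpo_answer). unfold inst; cbn [fsubst].
  apply mor_all2; intros H0 _. rewrite !fsubst_holds.
  apply imp_intro; intros H _ h. exact (lpo_answer_correct K h).
Qed.

(** * Floor inverses, pairs and stacks *)

(** [finv tau w n] is the largest [q] with [tau @ q <= n], when [w] is the
    largest [q] with [tau @ q <= 0]. *)
Definition finv_step : tm [] (Arr one (Arr N (Arr N N))) :=
  lam (lam (lam (ite (monus (v2 @ (Succ @ v1)) (Succ @ v0)) (Succ @ v1) v1))).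

Definition finv {G} (tau : tm G one) (w n : tm G N) : tm G N :=
  Rec @ n @ w @ (cl finv_step @ tau).

Lemma tsubst_finv G D (f : sub G D) tau w n :
  tsubst f (finv tau w n) = finv (tsubst f tau) (tsubst f w) (tsubst f n).
Proof. unfold finv; nat_subst. Qed.
Hint Rewrite tsubst_finv : subst.

Lemma finv_0 G (H : list (fm G)) tau w : eqv H (finv tau w Zero) w.
Proof. apply p_ax, ax_rec_zero. Qed.

Lemma finv_S G (H : list (fm G)) tau w n :
  eqv H (finv tau w (Succ @ n))
    (ite (monus (tau @ (Succ @ finv tau w n)) (Succ @ n))
      (Succ @ finv tau w n) (finv tau w n)).
Proof.
  etransitivity; [apply p_ax, ax_rec_succ|].
  exact (beta3 (ite (monus (v2 @ (Succ @ v1)) (Succ @ v0)) (Succ @ v1) v1) H tau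
    (finv tau w n) n).
Qed.

(** The instances are the triangular root and division by [k]. Strict growth is required only from
    argument 1 on, since [tri] vanishes at both 0 and 1; for the same reason the start [w] is a
    parameter. *)
Record stepping (tau : tm [] one) (w : tm [] N) : Prop := {
  stepping_0 : forall G (H : list (fm G)), prov H (le (cl tau @ cl w) Zero);
  stepping_S : forall G (H : list (fm G)),
    prov H (lt Zero (cl tau @ (Succ @ cl w)));
  stepping_mono : forall G (H : list (fm G)) a b,
    prov H (le a b) -> prov H (le (cl tau @ a) (cl tau @ b));
  stepping_lt : forall G (H : list (fm G)) a,
    prov H (lt (cl tau @ (Succ @ a)) (cl tau @ (Succ @ (Succ @ a)))) }.

Section FloorInverse.
Variables (tau : tm [] one) (w : tm [] N).
Hypothesis st : stepping tau w.

(** Raising [n] by one raises the inverse by at most one, because [tau] grows strictly there; hence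
    one comparison per step is enough. *)
Lemma finv_spec G (H : list (fm G)) n :
  prov H (And (le (cl tau @ finv (cl tau) (cl w) n) n)
              (lt n (cl tau @ (Succ @ finv (cl tau) (cl w) n)))).
Proof.
  refine (@qf_induction [] (fun G n _ =>
    And (le (cl tau @ finv (cl tau) (cl w) n) n)
        (lt n (cl tau @ (Succ @ finv (cl tau) (cl w) n)))) _ _ _ _ _ _ n tt).
  - intros; cbn; tauto.
  - nat_subst.
  - intros G' H' _. apply p_andI; rewrite finv_0;
      [apply (stepping_0 st) | apply (stepping_S st)].
  - clear G H n; intros G H n _ IH.
    set (r := finv (cl tau) (cl w) n) in *.
    pose proof (p_andE1 IH) as h1; pose proof (p_andE2 IH) as h2.
    nat_c (monus (cl tau @ (Succ @ r)) (Succ @ n)) d hd.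
    + assert (E : eqv H (finv (cl tau) (cl w) (Succ @ n)) (Succ @ r))
        by (rewrite finv_S; fold r; now rewrite hd, ite_0).
      apply p_andI; rewrite E; [exact hd|].
      apply le_SS in h2. refine (le_trans h2 _). apply (stepping_lt st).
    + assert (E : eqv H (finv (cl tau) (cl w) (Succ @ n)) r)
        by (rewrite finv_S; fold r; now rewrite hd, ite_S).
      apply p_andI; rewrite E; [exact (le_trans h1 (le_S _ _))|].
      apply monus_pos. rewrite hd; apply lt_0S.
Qed.

Lemma finv_le G (H : list (fm G)) n :
  prov H (le (cl tau @ finv (cl tau) (cl w) n) n).
Proof. exact (p_andE1 (finv_spec H n)). Qed.

Lemma finv_lt G (H : list (fm G)) n :
  prov H (lt n (cl tau @ (Succ @ finv (cl tau) (cl w) n))).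
Proof. exact (p_andE2 (finv_spec H n)). Qed.

Lemma le_finv G (H : list (fm G)) n r :
  prov H (le (cl tau @ r) n) -> prov H (le r (finv (cl tau) (cl w) n)).
Proof.
  intros h. or_e (le_total H r (finv (cl tau) (cl w) n)) h1 h1; [exact h1|].
  apply (lt_irrefl (a := n)). refine (le_trans (finv_lt _ _) (le_trans _ h)).
  now apply (stepping_mono st).
Qed.

Lemma finv_mono G (H : list (fm G)) n m :
  prov H (le n m) ->
  prov H (le (finv (cl tau) (cl w) n) (finv (cl tau) (cl w) m)).
Proof. intros h. apply le_finv. exact (le_trans (finv_le _ _) h). Qed.

Lemma finv_unique G (H : list (fm G)) n r :
  prov H (le (cl tau @ r) n) -> prov H (lt n (cl tau @ (Succ @ r))) ->
  eqv H (finv (cl tau) (cl w) n) r.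
Proof.
  intros h1 h2. apply le_antisym; [|now apply le_finv].
  or_e (le_total H (finv (cl tau) (cl w) n) r) h h; [exact h|].
  apply (lt_irrefl (a := n)). refine (le_trans h2 (le_trans _ (finv_le _ _))).
  now apply (stepping_mono st).
Qed.

End FloorInverse.

(** * Projections of the pairing *)

Definition tri_term : tm [] one := lam (tri v0).

Lemma tri_term_eq G (H : list (fm G)) n : eqv H (cl tri_term @ n) (tri n).
Proof. exact (beta1 (tri v0) H n). Qed.

Lemma stepping_tri : stepping tri_term (Succ @ Zero).
Proof.
  split; intros; rewrite ?tri_term_eq; cbn [cl tsubst].
  - rewrite tri_S, tri_0, add_0l. apply le_refl.
  - rewrite !tri_S, tri_0, !add_0l. apply lt_0S.
  - now apply tri_mono.
  - rewrite (tri_S H (Succ @ a)), add_Sr. apply le_SS, le_add.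
Qed.

(** As [pair a b] is the triangular number of a + b + 1 plus [a], its triangular root is a + b + 1,
    and both components follow by subtraction. *)
Definition root_term : tm [] one := lam (finv (cl tri_term) (Succ @ Zero) v0).
Definition left_term : tm [] one := lam (monus v0 (tri (cl root_term @ v0))).
Definition right_term : tm [] one :=
  lam (monus (pred (cl root_term @ v0)) (cl left_term @ v0)).

Lemma root_term_eq G (H : list (fm G)) n :
  eqv H (cl root_term @ n) (finv (cl tri_term) (cl (Succ @ Zero)) n).
Proof.
  unfold root_term; rewrite beta1. rewrite tsubst_finv, tsubst_cl. reflexivity.
Qed.

Lemma left_term_eq G (H : list (fm G)) n :
  eqv H (cl left_term @ n) (monus n (tri (cl root_term @ n))).
Proof.
  unfold left_term; rewrite beta1. rewrite tsubst_monus. unfold tri.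
  cbn [tsubst]. rewrite tsubst_cl. reflexivity.
Qed.

Lemma right_term_eq G (H : list (fm G)) n :
  eqv H (cl right_term @ n)
    (monus (pred (cl root_term @ n)) (cl left_term @ n)).
Proof.
  unfold right_term; rewrite beta1. autorewrite with subst. cbn [tsubst].
  rewrite !tsubst_cl. reflexivity.
Qed.

Lemma root_pair G (H : list (fm G)) a b :
  eqv H (cl root_term @ pair a b) (Succ @ add a b).
Proof.
  rewrite root_term_eq. apply (finv_unique stepping_tri); rewrite tri_term_eq.
  - apply le_add.
  - rewrite tri_S. unfold lt, pair, edge. rewrite <- add_Sr.
    apply add_le_mono; [apply le_refl | apply le_SS, le_add].
Qed.

Lemma left_pair G (H : list (fm G)) a b : eqv H (cl left_term @ pair a b) a.
Proof. now rewrite left_term_eq, root_pair; unfold pair, edge; rewrite monus_add. Qed.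

Lemma right_pair G (H : list (fm G)) a b : eqv H (cl right_term @ pair a b) b.
Proof. now rewrite right_term_eq, root_pair, left_pair, pred_S, monus_add. Qed.

Section Upper.
Variable K : nat.

(** With [k = S K] colors, a stack of colors is a number in base [k] whose last
    digit is the top of the stack. *)
Definition times_step : tm [] (Arr N (Arr N (Arr N N))) :=
  lam (lam (lam (add v2 v1))).

Definition times {G} (s : tm G N) : tm G N :=
  Rec @ s @ Zero @ (cl times_step @ numeral (S K)).

#[export] Instance times_proper G (H : list (fm G)) :
  Proper (eqv H ==> eqv H) (@times G).
Proof. intros a b D; unfold times; now rewrite D. Qed.

Lemma tsubst_times G D (f : sub G D) s : tsubst f (times s) = times (tsubst f s).
Proof. unfold times; nat_subst. Qed.
Hint Rewrite tsubst_times : subst.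

Lemma times_0 G (H : list (fm G)) : eqv H (times Zero) Zero.
Proof. apply p_ax, ax_rec_zero. Qed.

Lemma times_S G (H : list (fm G)) s :
  eqv H (times (Succ @ s)) (Succ @ add (numeral K) (times s)).
Proof.
  etransitivity; [apply p_ax, ax_rec_succ|]. rewrite <- add_Sl.
  exact (beta3 (add v2 v1) H (numeral (S K)) (times s) s).
Qed.

Lemma times_mono G (H : list (fm G)) a b :
  prov H (le a b) -> prov H (le (times a) (times b)).
Proof.
  intros h; destruct (le_elim h) as [d E]. rewrite E, add_comm. clear.
  qind [N] (fun G n (e : env G [N]) =>
    le (times (fst e)) (times (add n (fst e)))) d (a, tt);
    destruct e as [a []]; simpl.
  - rewrite add_0l. apply le_refl.
  - intros IH. rewrite add_Sl, times_S, <- add_Sl.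
    exact (le_trans IH (le_add_r _ _ _)).
Qed.

Definition times_term : tm [] one := lam (times v0).

Lemma times_term_eq G (H : list (fm G)) n : eqv H (cl times_term @ n) (times n).
Proof. unfold times_term; rewrite beta1, tsubst_times. reflexivity. Qed.

Lemma stepping_times : stepping times_term Zero.
Proof.
  split; intros; rewrite ?times_term_eq; cbn [cl tsubst].
  - rewrite times_0. apply le_refl.
  - rewrite times_S. apply lt_0S.
  - now apply times_mono.
  - rewrite (times_S H (Succ @ a)). apply le_SS, le_add_r.
Qed.

(** Quotient and remainder of division by [S K]. *)
Definition tail_term : tm [] one := lam (finv (cl times_term) Zero v0).
Definition head_term : tm [] one := lam (monus v0 (times (cl tail_term @ v0))).

Lemma tail_term_eq G (H : list (fm G)) n :
  eqv H (cl tail_term @ n) (finv (cl times_term) (cl Zero) n).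
Proof.
  unfold tail_term; rewrite beta1, tsubst_finv, tsubst_cl. reflexivity.
Qed.

Lemma head_term_eq G (H : list (fm G)) n :
  eqv H (cl head_term @ n) (monus n (times (cl tail_term @ n))).
Proof.
  unfold head_term; rewrite beta1. autorewrite with subst. cbn [tsubst].
  rewrite !tsubst_cl. reflexivity.
Qed.

(** Colors out of range become 0, so that popping inverts [push] without side conditions. *)
Definition clip {G} (c : tm G N) : tm G N :=
  ite (monus c (numeral K)) c Zero.

#[export] Instance clip_proper G (H : list (fm G)) :
  Proper (eqv H ==> eqv H) (@clip G).
Proof. intros a b D; unfold clip; now rewrite D. Qed.

Lemma tsubst_clip G D (f : sub G D) c : tsubst f (clip c) = clip (tsubst f c).
Proof. unfold clip; nat_subst. Qed.
Hint Rewrite tsubst_clip : subst.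

Lemma clip_id G (H : list (fm G)) c :
  prov H (le c (numeral K)) -> eqv H (clip c) c.
Proof. intros h; unfold le in h; norm_eqv. unfold clip. now rewrite h, ite_0. Qed.

Lemma clip_le G (H : list (fm G)) c : prov H (le (clip c) (numeral K)).
Proof.
  nat_c (monus c (numeral K)) d hd; unfold clip; rewrite hd.
  - rewrite ite_0. exact hd.
  - rewrite ite_S. apply le_0l.
Qed.

(** The height is not recorded, as 0 is the empty stack and also any stack of zeros; it is therefore
    always passed along separately. *)
Definition push {G} (c s : tm G N) : tm G N := add (times s) (clip c).

#[export] Instance push_proper G (H : list (fm G)) :
  Proper (eqv H ==> eqv H ==> eqv H) (@push G).
Proof. intros a b D c d E; unfold push; now rewrite D, E. Qed.

Lemma tsubst_push G D (f : sub G D) c s :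
  tsubst f (push c s) = push (tsubst f c) (tsubst f s).
Proof. unfold push; nat_subst. Qed.
Hint Rewrite tsubst_push : subst.

Lemma tail_push G (H : list (fm G)) c s : eqv H (cl tail_term @ push c s) s.
Proof.
  rewrite tail_term_eq. apply (finv_unique stepping_times); rewrite times_term_eq.
  - apply le_add.
  - rewrite times_S, add_comm. apply le_SS, add_le_mono; [apply le_refl|].
    apply clip_le.
Qed.

Lemma head_push G (H : list (fm G)) c s :
  eqv H (cl head_term @ push c s) (clip c).
Proof. rewrite head_term_eq, tail_push. apply monus_add. Qed.

Lemma add_le_inv G (H : list (fm G)) a b c :
  prov H (le (add a b) (add a c)) -> prov H (le b c).
Proof.
  intros h; destruct (le_elim h) as [d E]. rewrite <- add_assoc in E.
  exact (le_intro (add_inj E)).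
Qed.

Lemma times_tail_le G (H : list (fm G)) z :
  prov H (le (times (cl tail_term @ z)) z).
Proof.
  rewrite tail_term_eq, <- times_term_eq. apply (finv_le stepping_times).
Qed.

Lemma head_le G (H : list (fm G)) z :
  prov H (le (cl head_term @ z) (numeral K)).
Proof.
  pose proof (finv_lt stepping_times H z) as h.
  rewrite times_term_eq, times_S, <- tail_term_eq in h. apply -> le_SS in h.
  rewrite head_term_eq.
  apply (add_le_inv (a := times (cl tail_term @ z))).
  rewrite (add_monus (times_tail_le H z)).
  now rewrite add_comm in h.
Qed.

Lemma push_head_tail G (H : list (fm G)) z :
  eqv H (push (cl head_term @ z) (cl tail_term @ z)) z.
Proof.
  unfold push. rewrite (clip_id (head_le H z)), head_term_eq.
  apply add_monus, times_tail_le.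
Qed.

Lemma tail_mono G (H : list (fm G)) a b :
  prov H (le a b) -> prov H (le (cl tail_term @ a) (cl tail_term @ b)).
Proof. intros h. rewrite !tail_term_eq. now apply (finv_mono stepping_times). Qed.

Lemma push_le G (H : list (fm G)) c s s' :
  prov H (le s s') -> prov H (le (push c s) (push (numeral K) s')).
Proof.
  intros h. apply add_le_mono; [now apply times_mono|].
  rewrite (clip_id (le_refl H (numeral K))). apply clip_le.
Qed.

Definition anc_step : tm [] (Arr N (Arr N N)) := lam (lam (cl tail_term @ v1)).

(** The stack [x] after [t] pops. *)
Definition anc {G} (x t : tm G N) : tm G N := Rec @ t @ x @ cl anc_step.

#[export] Instance anc_proper G (H : list (fm G)) :
  Proper (eqv H ==> eqv H ==> eqv H) (@anc G).
Proof. intros a b D c d E; unfold anc; now rewrite D, E. Qed.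

Lemma tsubst_anc G D (f : sub G D) x t :
  tsubst f (anc x t) = anc (tsubst f x) (tsubst f t).
Proof. unfold anc; nat_subst. Qed.
Hint Rewrite tsubst_anc : subst.

Lemma anc_0 G (H : list (fm G)) x : eqv H (anc x Zero) x.
Proof. apply p_ax, ax_rec_zero. Qed.

Lemma anc_S G (H : list (fm G)) x t :
  eqv H (anc x (Succ @ t)) (cl tail_term @ anc x t).
Proof.
  etransitivity; [apply p_ax, ax_rec_succ|].
  unfold anc_step; rewrite beta2; cbn [tsubst]; rewrite tsubst_cl. reflexivity.
Qed.

Lemma anc_anc G (H : list (fm G)) x a b :
  eqv H (anc (anc x a) b) (anc x (add b a)).
Proof.
  qind [N; N] (fun G n (e : env G [N; N]) =>
    let x := fst e in let a := fst (snd e) in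
    Eq (anc (anc x a) n) (anc x (add n a))) b (x, (a, tt));
    destruct e as [x [a []]]; cbn [fst snd].
  - norm_eqv. now rewrite anc_0, add_0l.
  - intros IH; norm_eqv. now rewrite add_Sl, !anc_S, IH.
Qed.

Definition stack_step : tm [] (Arr (Arr N one) (Arr N one)) :=
  lam (lam (lam (push (v2 @ v1 @ v0) v1))).

(** The stack of height [n] whose entries are computed by [g] from the stack
    below them and their position. *)
Definition stack {G} (g : tm G (Arr N one)) (n : tm G N) : tm G N :=
  Rec @ n @ Zero @ (cl stack_step @ g).

#[export] Instance stack_proper G (H : list (fm G)) :
  Proper (eqv H ==> eqv H ==> eqv H) (@stack G).
Proof. intros a b D c d E; unfold stack; now rewrite D, E. Qed.

Lemma tsubst_stack G D (f : sub G D) g n :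
  tsubst f (stack g n) = stack (tsubst f g) (tsubst f n).
Proof. unfold stack; nat_subst. Qed.
Hint Rewrite tsubst_stack : subst.

Lemma stack_0 G (H : list (fm G)) g : eqv H (stack g Zero) Zero.
Proof. apply p_ax, ax_rec_zero. Qed.

Lemma stack_S G (H : list (fm G)) g n :
  eqv H (stack g (Succ @ n)) (push (g @ stack g n @ n) (stack g n)).
Proof.
  etransitivity; [apply p_ax, ax_rec_succ|].
  unfold stack_step; rewrite beta3, tsubst_push. reflexivity.
Qed.

Lemma tail_stack G (H : list (fm G)) g n :
  eqv H (cl tail_term @ stack g n) (stack g (pred n)).
Proof.
  nat_c n m hm; rewrite hm.
  - now rewrite pred_0, stack_0, tail_term_eq, finv_0.
  - now rewrite pred_S, stack_S, tail_push.
Qed.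

Lemma head_stack G (H : list (fm G)) g n :
  eqv H (cl head_term @ stack g (Succ @ n)) (clip (g @ stack g n @ n)).
Proof. now rewrite stack_S, head_push. Qed.

Lemma anc_stack G (H : list (fm G)) g m t :
  eqv H (anc (stack g m) t) (stack g (monus m t)).
Proof.
  qind [Arr N one; N] (fun G n (e : env G [Arr N one; N]) =>
    let g := fst e in let m := fst (snd e) in
    Eq (anc (stack g m) n) (stack g (monus m n))) t (g, (m, tt));
    destruct e as [g [m []]]; cbn [fst snd].
  - norm_eqv. now rewrite anc_0, monus_0r.
  - intros IH; norm_eqv. now rewrite anc_S, IH, tail_stack, monus_Sr.
Qed.

(** The number k^n - 1, the largest stack of height [n], which bounds searches through colorings. *)
Definition full {G} (n : tm G N) : tm G N :=
  stack (Pi _ _ @ (Pi _ _ @ numeral K)) n.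

#[export] Instance full_proper G (H : list (fm G)) :
  Proper (eqv H ==> eqv H) (@full G).
Proof. intros a b D; unfold full; now rewrite D. Qed.

Lemma tsubst_full G D (f : sub G D) n : tsubst f (full n) = full (tsubst f n).
Proof. unfold full; nat_subst. Qed.
Hint Rewrite tsubst_full : subst.

Lemma full_S G (H : list (fm G)) n :
  eqv H (full (Succ @ n)) (push (numeral K) (full n)).
Proof.
  unfold full; rewrite stack_S. apply push_proper; [|reflexivity].
  transitivity (Pi _ N @ numeral K @ n); [apply App_proper; [|reflexivity] |];
    apply p_ax, ax_pi.
Qed.

Lemma stack_le_full G (H : list (fm G)) g n : prov H (le (stack g n) (full n)).
Proof.
  qind [Arr N one] (fun G n (e : env G [Arr N one]) =>
    le (stack (fst e) n) (full n)) n (g, tt); destruct e as [g []]; cbn [fst].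
  - rewrite stack_0. apply le_0l.
  - intros IH. rewrite stack_S, full_S. now apply push_le.
Qed.

Lemma anc_le_full G (H : list (fm G)) x m t :
  prov H (le x (full m)) -> prov H (le (anc x t) (full (monus m t))).
Proof.
  apply p_impE.
  qind [N; N] (fun G n (e : env G [N; N]) =>
    let x := fst e in let m := fst (snd e) in
    Imp (le x (full m)) (le (anc x n) (full (monus m n)))) t (x, (m, tt));
    destruct e as [x [m []]]; cbn [fst snd].
  - imp_i h. now rewrite anc_0, monus_0r.
  - intros IH; imp_i h. rewrite anc_S, monus_Sr.
    unfold full at 1. rewrite <- tail_stack. apply tail_mono.
    exact (p_impE IH h).
Qed.

(** * From colorings to parallel LPO *)

Local Notation v3 := (Var (VS (VS (VS VZ)))).

(** The color of vertex [v] in the coloring of [{0, ..., m}] given by the stack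
    [x], on top of which lies the color of [m]. *)
Definition color {G} (m x v : tm G N) : tm G N :=
  cl head_term @ anc x (monus m v).

#[export] Instance color_proper G (H : list (fm G)) :
  Proper (eqv H ==> eqv H ==> eqv H ==> eqv H) (@color G).
Proof. intros a b D c d E x y F; unfold color; now rewrite D, E, F. Qed.

Lemma tsubst_color G D (f : sub G D) m x v :
  tsubst f (color m x v) = color (tsubst f m) (tsubst f x) (tsubst f v).
Proof. unfold color; nat_subst. Qed.
Hint Rewrite tsubst_color : subst.

(** Expresses equality by the vanishing of a term, as [search] requires; conjunctions become sums in
    the same way. *)
Definition dist {G} (a b : tm G N) : tm G N := add (monus a b) (monus b a).

#[export] Instance dist_proper G (H : list (fm G)) :
  Proper (eqv H ==> eqv H ==> eqv H) (@dist G).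
Proof. intros a b D c d E; unfold dist; now rewrite D, E. Qed.

Lemma tsubst_dist G D (f : sub G D) a b :
  tsubst f (dist a b) = dist (tsubst f a) (tsubst f b).
Proof. reflexivity. Qed.
Hint Rewrite tsubst_dist : subst.

Lemma dist_0 G (H : list (fm G)) a b : eqv H (dist a b) Zero -> eqv H a b.
Proof.
  intros h. apply le_antisym; [exact (add_eq0_l h) | exact (add_eq0_r h)].
Qed.

Lemma dist_diag G (H : list (fm G)) a : eqv H (dist a a) Zero.
Proof. unfold dist. now rewrite monus_diag, add_0l. Qed.

(** [0] iff [a < b <= m] are adjacent and have the same color in [x]. *)
Definition clash {G} (e : tm G one) (m x a b : tm G N) : tm G N :=
  add (monus (Succ @ a) b) (add (monus b m)
    (add (monus (Succ @ Zero) (e @ edge a b)) (dist (color m x a) (color m x b)))).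

#[export] Instance clash_proper G (H : list (fm G)) :
  Proper (eqv H ==> eqv H ==> eqv H ==> eqv H ==> eqv H ==> eqv H) (@clash G).
Proof.
  intros ? ? D ? ? E ? ? F ? ? I ? ? J; unfold clash; now rewrite D, E, F, I, J.
Qed.

Lemma tsubst_clash G D (f : sub G D) e m x a b :
  tsubst f (clash e m x a b) =
  clash (tsubst f e) (tsubst f m) (tsubst f x) (tsubst f a) (tsubst f b).
Proof. unfold clash; nat_subst. Qed.

Lemma clash_elim G (H : list (fm G)) e m x a b :
  eqv H (clash e m x a b) Zero ->
  prov H (lt a b) /\ prov H (le b m) /\ prov H (lt Zero (e @ edge a b)) /\
  eqv H (color m x a) (color m x b).
Proof.
  intros h. repeat split.
  - exact (add_eq0_l h).
  - exact (add_eq0_l (add_eq0_r h)).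
  - exact (add_eq0_l (add_eq0_r (add_eq0_r h))).
  - apply dist_0. exact (add_eq0_r (add_eq0_r (add_eq0_r h))).
Qed.

Lemma clash_intro G (H : list (fm G)) e m x a b :
  prov H (lt a b) -> prov H (le b m) -> prov H (lt Zero (e @ edge a b)) ->
  eqv H (color m x a) (color m x b) -> eqv H (clash e m x a b) Zero.
Proof.
  intros h1 h2 h3 h4. unfold lt, le in *; norm_eqv. unfold clash.
  now rewrite h1, h2, h3, h4, dist_diag, !add_0l.
Qed.

Definition clash_term : tm [] (Arr one (Arr N (Arr N one))) :=
  lam (lam (lam (lam
    (clash v3 v2 v1 (cl left_term @ v0) (cl right_term @ v0))))).

Lemma clash_term_eq G (H : list (fm G)) e m x z :
  eqv H (cl clash_term @ e @ m @ x @ z)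
    (clash e m x (cl left_term @ z) (cl right_term @ z)).
Proof.
  unfold clash_term; rewrite beta4, tsubst_clash; cbn [tsubst].
  rewrite !tsubst_cl. reflexivity.
Qed.

(** [0] iff the stack [x] gives a coloring of the subgraph on [{0, ..., m}]. *)
Definition clashes {G} (e : tm G one) (m x : tm G N) : tm G N :=
  search (cl clash_term @ e @ m @ x) (Succ @ pair m m).

Lemma tsubst_clashes G D (f : sub G D) e m x :
  tsubst f (clashes e m x) = clashes (tsubst f e) (tsubst f m) (tsubst f x).
Proof. unfold clashes; nat_subst. Qed.

Lemma clashes_elim G (H : list (fm G)) e m x a b A :
  eqv H (clashes e m x) Zero -> prov H (lt a b) -> prov H (le b m) ->
  prov H (lt Zero (e @ edge a b)) -> eqv H (color m x a) (color m x b) ->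
  prov H A.
Proof.
  intros h h1 h2 h3 h4.
  assert (h5 : prov H (lt (pair a b) (Succ @ pair m m))).
  { apply le_SS, pair_mono; [exact (le_trans (lt_le h1) h2) | exact h2]. }
  pose proof (search_complete h5 h) as h6.
  rewrite clash_term_eq, left_pair, right_pair, clash_intro in h6 by assumption.
  exact (lt_irrefl _ h6).
Qed.

Lemma clashes_intro G (H : list (fm G)) e m x :
  (forall H' a b, ext H H' -> prov H' (lt a b) -> prov H' (le b m) ->
    prov H' (lt Zero (e @ edge a b)) -> eqv H' (color m x a) (color m x b) ->
    prov H' Bot) ->
  eqv H (clashes e m x) Zero.
Proof.
  intros D.
  apply (or_elim (search_sound H (cl clash_term @ e @ m @ x) (Succ @ pair m m)));
    intros H' w h; [exact h|].
  pose proof (p_andE1 h) as h1; norm_eqv. rewrite clash_term_eq in h1.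
  destruct (clash_elim h1) as (h2 & h3 & h4 & h5).
  exact (p_botE _ (D H' _ _ w h2 h3 h4 h5)).
Qed.

Lemma color_anc G (H : list (fm G)) m m' x v :
  prov H (le v m') -> prov H (le m' m) ->
  eqv H (color m' (anc x (monus m m')) v) (color m x v).
Proof.
  intros h1 h2. unfold color. now rewrite anc_anc, monus_add_monus.
Qed.

(** Popping the colors of the vertices above [m'] leaves those of the others unchanged, so a
    coloring restricts. *)
Lemma clashes_anc G (H : list (fm G)) e m m' x :
  prov H (le m' m) -> eqv H (clashes e m x) Zero ->
  eqv H (clashes e m' (anc x (monus m m'))) Zero.
Proof.
  intros h h'. apply clashes_intro; intros H' a b w h1 h2 h3 h4; lift w.
  rewrite !color_anc in h4 by eauto using le_trans, lt_le.
  apply (clashes_elim _ h' h1); eauto using le_trans.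
Qed.

(** [0] iff [x] codes a coloring of [{0, ..., m}] that extends the coloring of
    [{0, ..., n-1}] coded by [s]. *)
Definition miss {G} (e : tm G one) (m n s x : tm G N) : tm G N :=
  add (clashes e m x) (dist (anc x (monus (Succ @ m) n)) s).

Lemma tsubst_miss G D (f : sub G D) e m n s x :
  tsubst f (miss e m n s x) =
  miss (tsubst f e) (tsubst f m) (tsubst f n) (tsubst f s) (tsubst f x).
Proof.
  unfold miss; cbn [tsubst]; rewrite tsubst_add, tsubst_clashes. nat_subst.
Qed.

(** The parameters [n] and [s] are decoded from the stage itself, so one function of the stage
    serves all questions. *)
Definition miss_term : tm [] (Arr one (Arr N one)) :=
  lam (lam (lam (miss v2 v1 (cl left_term @ (cl left_term @ v1))
    (cl right_term @ (cl left_term @ v1)) v0))).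

Lemma miss_term_eq G (H : list (fm G)) e n s j x :
  let m := pair (pair n s) j in
  eqv H (cl miss_term @ e @ m @ x) (miss e m n s x).
Proof.
  intros m. unfold miss_term; rewrite beta3, tsubst_miss; cbn [tsubst].
  rewrite !tsubst_cl. cbn [scons].
  assert (E : eqv H (cl left_term @ m) (pair n s)) by apply left_pair.
  unfold miss. now rewrite E, left_pair, right_pair.
Qed.

(** The question with number [pair n s] asks whether the coloring of
    [{0, ..., n-1}] coded by [s] extends to [{0, ..., m}] for all [m]. It is asked
    at the stages [m = pair (pair n s) j], all of which are at least [n]. *)
Definition questions_term : tm [] (Arr one one) :=
  lam (lam (search (cl miss_term @ v1 @ v0) (Succ @ full (Succ @ v0)))).

Lemma questions_eq G (H : list (fm G)) e m :
  eqv H (cl questions_term @ e @ m)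
    (search (cl miss_term @ e @ m) (Succ @ full (Succ @ m))).
Proof.
  unfold questions_term; rewrite beta2; rewrite tsubst_search; cbn [tsubst].
  rewrite tsubst_full, tsubst_cl. reflexivity.
Qed.

Lemma questions_elim G (H : list (fm G)) e n s j :
  let m := pair (pair n s) j in
  prov H (lt Zero (cl questions_term @ e @ m)) ->
  exists x, prov H (le x (full (Succ @ m))) /\ eqv H (clashes e m x) Zero /\
    eqv H (anc x (monus (Succ @ m) n)) s.
Proof.
  intros m h. rewrite questions_eq in h.
  set (r := search (cl miss_term @ e @ m) (Succ @ full (Succ @ m))) in *.
  exists (pred r).
  (* The witness is fixed before the case distinction, since a disjunction of the object theory can
     be eliminated only into provability. *)
  assert (D : prov H (And (Eq (cl miss_term @ e @ m @ pred r) Zero)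
                          (le r (Succ @ full (Succ @ m))))).
  { or_e (search_sound H (cl miss_term @ e @ m) (Succ @ full (Succ @ m))) h1 h1;
      fold r in h1.
    - rewrite h1 in h. exact (lt_irrefl _ h).
    - exact (p_andI (p_andE1 h1) (p_andE2 (p_andE2 h1))). }
  pose proof (p_andE1 D) as h1; pose proof (p_andE2 D) as h2; norm_eqv.
  unfold m in h1; rewrite miss_term_eq in h1; fold m in h1.
  repeat split.
  - apply le_SS. now rewrite <- (pos_elim h).
  - exact (add_eq0_l h1).
  - exact (dist_0 (add_eq0_r h1)).
Qed.

Lemma questions_intro G (H : list (fm G)) e n s j x :
  let m := pair (pair n s) j in
  prov H (le x (full (Succ @ m))) -> eqv H (clashes e m x) Zero ->
  eqv H (anc x (monus (Succ @ m) n)) s ->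
  prov H (lt Zero (cl questions_term @ e @ m)).
Proof.
  intros m h1 h2 h3. rewrite questions_eq. apply search_pos with x.
  - now apply le_SS.
  - unfold m; rewrite miss_term_eq; fold m. unfold miss.
    now rewrite h2, h3, dist_diag, add_0l.
Qed.

(** * Reading the LPO answers and following the path *)

Lemma hat_lpo G (H : list (fm G)) p y i :
  prov H (holds LPO_hat p y) -> prov H (lpo (section @ p @ i) (y @ i)).
Proof.
  intros h.
  change (prov H (All N (lpo (section @ wk p @ v0) (wk y @ v0)))) in h.
  pose proof (p_allE i h) as h'. unfold inst in h'. rewrite fsubst_lpo in h'.
  cbn [tsubst] in h'. now rewrite !tsubst_inst_wk in h'.
Qed.

Lemma section_eq G (H : list (fm G)) p i j :
  eqv H (section @ p @ i @ j) (p @ pair i j).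
Proof. exact (beta3 (v2 @ pair v1 v0) H p i j). Qed.

Lemma hat_pos G (H : list (fm G)) p y i j :
  prov H (holds LPO_hat p y) -> eqv H (y @ i) Zero ->
  prov H (lt Zero (p @ pair i j)).
Proof. intros h h1. rewrite <- section_eq. exact (lpo_pos _ (hat_lpo _ h) h1). Qed.

Lemma hat_zero G (H : list (fm G)) p y i :
  prov H (holds LPO_hat p y) -> prov H (lt Zero (y @ i)) ->
  eqv H (p @ pair i (pred (y @ i))) Zero.
Proof.
  intros h h1. rewrite <- section_eq. exact (lpo_zero (hat_lpo _ h) h1).
Qed.

(** The bound is the sum of the values at 0, ..., k - 1, a term because [k] is standard. *)
Lemma bound_below G (f : tm G N -> tm G N) k :
  (forall H a b, eqv H a b -> eqv H (f a) (f b)) ->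
  exists m, forall H c, prov H (lt c (numeral k)) -> prov H (le (f c) m).
Proof.
  intros ff. induction k as [|k [m D]].
  - exists Zero. intros H c h. exact (lt_0r _ h).
  - exists (add m (f (numeral k))). intros H c h. apply -> le_SS in h.
    or_e (le_cases h) h1 h1.
    + rewrite (ff _ _ _ h1). apply le_add_r.
    + exact (le_trans (D _ _ h1) (le_add _ _ _)).
Qed.

Definition child_term : tm [] (Arr one (Arr N (Arr N one))) :=
  lam (lam (lam (lam (v3 @ pair (Succ @ v2) (push v0 v1))))).

Lemma child_eq G (H : list (fm G)) y n s c :
  eqv H (cl child_term @ y @ n @ s @ c) (y @ pair (Succ @ n) (push c s)).
Proof.
  unfold child_term; rewrite beta4; cbn [tsubst].
  rewrite tsubst_pair, tsubst_push. reflexivity.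
Qed.

(** Every coloring that extends to all stages has a child that does, as otherwise
    none of the finitely many children would extend to a common late stage. *)
Lemma child_exists G (H : list (fm G)) e y n s :
  prov H (holds LPO_hat (cl questions_term @ e) y) ->
  eqv H (y @ pair n s) Zero ->
  eqv H (search (cl child_term @ y @ n @ s) (numeral (S K))) Zero -> prov H Bot.
Proof.
  intros h h1 h2.
  set (node := fun c => pair (Succ @ n) (push c s)).
  destruct (@bound_below G (fun c => pair (node c) (pred (y @ node c))) (S K))
    as [j hj].
  { intros H' a b E. unfold node. now rewrite E. }
  (* The stage [m] of the question about [s] is at least [j], hence no earlier than any stage that
     refutes a child. *)
  set (m := pair (pair n s) j).
  pose proof (hat_pos j h h1) as h3. fold m in h3.
  destruct (questions_elim h3) as (x & h4 & h5 & h6); fold m in h4, h5, h6.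
  assert (nm : prov H (le n m)).
  { refine (le_trans (le_pair_l _ _ s) _). apply le_pair_l. }
  (* The restriction of [x] to {0, ..., n}: the child of [s] through which [x] passes. *)
  set (z := anc x (monus m n)).
  set (c := cl head_term @ z).
  assert (hs : eqv H (cl tail_term @ z) s)
    by now rewrite monus_S_l, anc_S in h6 by exact nm.
  assert (hz : eqv H (push c s) z) by (rewrite <- hs; apply push_head_tail).
  assert (hc : prov H (lt c (numeral (S K)))) by apply le_SS, head_le.
  assert (hy : prov H (lt Zero (y @ node c))).
  { pose proof (search_complete hc h2) as h7. now rewrite child_eq in h7. }
  pose proof (hj H c hc) as h7. pose proof (hat_zero h hy) as h8.
  set (m' := pair (node c) (pred (y @ node c))) in *.
  assert (mm : prov H (le m' m)) by exact (le_trans h7 (le_pair_r _ _ _)).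
  assert (nm' : prov H (le n m')).
  { refine (le_trans (le_S _ _) (le_trans _ (le_pair_l _ _ _))).
    apply le_pair_l. }
  (* Cut down to the stage [m'] that refutes this child, [x] is an extension of it after all. *)
  assert (h9 : prov H (lt Zero (cl questions_term @ e @ m'))).
  { apply questions_intro with (anc x (monus m m'));
      change (pair (pair (Succ @ n) (push c s)) (pred (y @ node c))) with m'.
    - rewrite <- (monus_S_monus mm). now apply anc_le_full.
    - now apply clashes_anc.
    - rewrite monus_SS, anc_anc, monus_add_monus by assumption. now symmetry. }
  rewrite h8 in h9. exact (lt_irrefl _ h9).
Qed.

Definition choose_term : tm [] (Arr one (Arr N one)) :=
  lam (lam (lam (pred (search (cl child_term @ v2 @ v0 @ v1) (numeral (S K)))))).

(** The leftmost path through the tree of colorings that [y] claims extendible. *)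
Definition path {G} (y : tm G one) (n : tm G N) : tm G N :=
  stack (cl choose_term @ y) n.

Lemma tsubst_path G D (f : sub G D) y n :
  tsubst f (path y n) = path (tsubst f y) (tsubst f n).
Proof. unfold path; nat_subst. Qed.
Hint Rewrite tsubst_path : subst.

Lemma path_S G (H : list (fm G)) y n :
  eqv H (path y (Succ @ n))
    (push (pred (search (cl child_term @ y @ n @ path y n) (numeral (S K))))
      (path y n)).
Proof.
  unfold path at 1; rewrite stack_S. fold (path y n).
  apply push_proper; [|reflexivity].
  unfold choose_term; rewrite beta3, tsubst_pred, tsubst_search, tsubst_numeral.
  cbn [tsubst]; rewrite tsubst_cl. reflexivity.
Qed.

(** Correctness of [y] is not quantifier-free, so it is the side condition of the induction; the
    induction formula is only an equation about [y]. *)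
Lemma path_extendible G (H : list (fm G)) e y n :
  prov H (holds LPO_hat (cl questions_term @ e) y) ->
  eqv H (y @ pair Zero Zero) Zero -> eqv H (y @ pair n (path y n)) Zero.
Proof.
  intros h h0.
  refine (@qf_induction_under [one; one]
    (fun G e => And (holds LPO_hat (cl questions_term @ fst e) (fst (snd e)))
                    (Eq (fst (snd e) @ pair Zero Zero) Zero))
    (fun G n e => let y := fst (snd e) in Eq (y @ pair n (path y n)) Zero)
    _ _ _ _ _ _ H n (e, (y, tt)) (p_andI h h0)).
  - intros; cbn [fsubst]. rewrite fsubst_holds. nat_subst.
  - intros; cbn; tauto.
  - nat_subst.
  - clear; intros G H [e [y []]] h; cbn [fst snd] in *.
    pose proof (p_andE2 h) as h0; norm_eqv.
    unfold path; now rewrite stack_0.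
  - clear; intros G H n [e [y []]] hh h2; cbn [fst snd] in *.
    pose proof (p_andE1 hh) as h; clear hh; norm_eqv.
    or_e (search_sound H (cl child_term @ y @ n @ path y n) (numeral (S K))) h3 h3.
    + exact (p_botE _ (child_exists h h2 h3)).
    + pose proof (p_andE1 h3) as h4; norm_eqv.
      now rewrite child_eq, <- path_S in h4.
Qed.

Lemma anc_path G (H : list (fm G)) y a b :
  prov H (le a b) ->
  eqv H (anc (path y (Succ @ b)) (monus b a)) (path y (Succ @ a)).
Proof. intros h. unfold path. now rewrite anc_stack, monus_S_monus. Qed.

(** Already the first stage for the node of height b + 1 provides a genuine coloring [x] of some {0,
    ..., m} with b <= m that agrees with the path up to [b]. *)
Lemma path_proper_coloring G (H : list (fm G)) e y a b :
  prov H (holds LPO_hat (cl questions_term @ e) y) ->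
  eqv H (y @ pair Zero Zero) Zero ->
  prov H (lt a b) -> prov H (lt Zero (e @ edge a b)) ->
  eqv H (cl head_term @ path y (Succ @ a)) (cl head_term @ path y (Succ @ b)) ->
  prov H Bot.
Proof.
  intros h h0 h1 h2 h3.
  pose proof (path_extendible (Succ @ b) h h0) as h4.
  pose proof (hat_pos Zero h h4) as h5.
  destruct (questions_elim h5) as (x & _ & h6 & h7).
  set (m := pair (pair (Succ @ b) (path y (Succ @ b))) Zero) in *.
  rewrite monus_SS in h7.
  assert (bm : prov H (le b m)).
  { refine (le_trans (le_S _ _) (le_trans (le_pair_l _ _ _) _)).
    apply le_pair_l. }
  refine (clashes_elim _ h6 h1 bm h2 _). unfold color.
  rewrite <- (monus_add_monus (lt_le h1) bm), <- anc_anc, h7.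
  now rewrite (anc_path y (lt_le h1)).
Qed.

(** Tabulated as a stack, [c] would contradict the negative answer at the root. The bound [m1] stays
    free because the announced value is m + 1, which has to be positive even if m = 0. *)
Lemma no_coloring G (H : list (fm G)) e y m1 c :
  let m := pair (pair Zero Zero) (pred (y @ pair Zero Zero)) in
  prov H (holds LPO_hat (cl questions_term @ e) y) ->
  prov H (lt Zero (y @ pair Zero Zero)) ->
  prov H (le m m1) -> prov H (coloring_upto (S K) e m1 c) -> prov H Bot.
Proof.
  intros m h h0 hm h1.
  pose proof (hat_zero h h0) as h2. fold m in h2.
  set (g := Pi one N @ c).
  assert (gE : forall H s i, eqv H (g @ s @ i) (c @ i)).
  { intros. apply App_proper; [|reflexivity]. apply p_ax, ax_pi. }
  assert (h3 : prov H (lt Zero (cl questions_term @ e @ m))).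
  { refine (@questions_intro _ _ e Zero Zero (pred (y @ pair Zero Zero))
      (stack g (Succ @ m)) _ _ _);
      change (pair (pair Zero Zero) (pred (y @ pair Zero Zero))) with m.
    - apply stack_le_full.
    - assert (D : forall H' v, ext H H' -> prov H' (le v m) ->
        eqv H' (color m (stack g (Succ @ m)) v) (c @ v)).
      { intros H' v w h4; lift w. unfold color.
        rewrite anc_stack, (monus_S_monus h4), head_stack, gE.
        apply clip_id, le_SS.
        exact (coloring_upto_lt h1 (le_trans h4 hm)). }
      apply clashes_intro; intros H' a b w h4 h5 h6 h7.
      rewrite !D in h7 by eauto using le_trans, lt_le.
      refine (coloring_upto_neq (w _ h1) h4 _ h6 h7).
      exact (le_trans h5 (w _ hm)).
    - rewrite anc_stack, monus_0r, monus_diag. apply stack_0. }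
  rewrite h2 in h3. exact (lt_irrefl _ h3).
Qed.

(** The transposition of the colors [0] and [a], applied to [b]. *)
Definition swap {G} (a b : tm G N) : tm G N := ite (dist b a) Zero (ite b a b).

#[export] Instance swap_proper G (H : list (fm G)) :
  Proper (eqv H ==> eqv H ==> eqv H) (@swap G).
Proof. intros a b D c d E; unfold swap; now rewrite D, E. Qed.

Lemma tsubst_swap G D (f : sub G D) a b :
  tsubst f (swap a b) = swap (tsubst f a) (tsubst f b).
Proof. unfold swap; nat_subst. Qed.

Lemma swap_diag G (H : list (fm G)) a : eqv H (swap a a) Zero.
Proof. unfold swap. now rewrite dist_diag, ite_0. Qed.

Lemma swap_0 G (H : list (fm G)) a : eqv H (swap a Zero) a.
Proof.
  nat_c (dist Zero a) d hd; unfold swap; rewrite hd.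
  - rewrite ite_0. now apply dist_0.
  - now rewrite ite_S, ite_0.
Qed.

Lemma swap_involutive G (H : list (fm G)) a b : eqv H (swap a (swap a b)) b.
Proof.
  nat_c (dist b a) d hd.
  - apply dist_0 in hd. now rewrite hd, swap_diag, swap_0.
  - nat_c b b' hb.
    + now rewrite hb, swap_0, swap_diag.
    + assert (E : eqv H (swap a b) b)
        by (unfold swap; now rewrite hd, ite_S, hb, ite_S).
      now rewrite E.
Qed.

Lemma swap_lt G (H : list (fm G)) a b c :
  prov H (lt a c) -> prov H (lt b c) -> prov H (lt (swap a b) c).
Proof.
  intros h1 h2. nat_c (dist b a) d hd; unfold swap; rewrite hd.
  - rewrite ite_0. exact (le_trans (proj2 (le_SS _ _ _) (le_0l _ _)) h2).
  - rewrite ite_S. nat_c b b' hb; rewrite hb.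
    + now rewrite ite_0.
    + now rewrite ite_S, <- hb.
Qed.

(** The value at vertex [0] also signals whether there is a coloring, hence the
    permutation of the colors that gives vertex [0] the color [0]. *)
Definition coloring_term : tm [] (Arr one one) :=
  lam (lam (ite (v1 @ pair Zero Zero)
    (swap (cl head_term @ path v1 (Succ @ Zero))
          (cl head_term @ path v1 (Succ @ v0)))
    (Succ @ pair (pair Zero Zero) (pred (v1 @ pair Zero Zero))))).

Lemma coloring_term_eq G (H : list (fm G)) y v :
  eqv H (cl coloring_term @ y @ v)
    (ite (y @ pair Zero Zero)
      (swap (cl head_term @ path y (Succ @ Zero))
            (cl head_term @ path y (Succ @ v)))
      (Succ @ pair (pair Zero Zero) (pred (y @ pair Zero Zero)))).
Proof.
  unfold coloring_term; rewrite beta2, tsubst_ite, tsubst_swap; cbn [tsubst].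
  rewrite !tsubst_path, !tsubst_cl. reflexivity.
Qed.

Lemma head_lt G (H : list (fm G)) z :
  prov H (lt (cl head_term @ z) (numeral (S K))).
Proof. apply le_SS, head_le. Qed.

Lemma mor_neg_ex G (H : list (fm G)) s A :
  (forall H', mor (shift s) H H' -> prov H' A -> prov H' Bot) ->
  prov H (Neg (Ex s A)).
Proof.
  intros D. apply imp_intro; intros H' w h. refine (p_exE Bot h _).
  apply D; [|apply p_hyp; now left].
  intros B d. apply ext_cons. exact (prov_wk s (w _ d)).
Qed.

Lemma TGC_from_hat G (H : list (fm G)) e y :
  prov H (holds LPO_hat (cl questions_term @ e) y) ->
  prov H (holds (TGC (S K)) e (cl coloring_term @ y)).
Proof.
  intros h. rewrite holds_TGC.
  apply p_andI; apply imp_intro; intros H' w h1; lift w; norm_eqv;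
    rewrite coloring_term_eq in h1.
  - or_e (zero_or_succ H (y @ pair Zero Zero)) h2 h2.
    (* A positive answer at the root would make the value at 0 a successor. *)
    2: { rewrite h2, ite_S in h1. exact (succ_zero_absurd _ h1). }
    clear h1. apply coloring_intro; intros D s H' m;
      pose proof (m _ h) as h'; pose proof (mor_eqv m h2) as h2';
      rewrite fsubst_holds in h'; cbn [tsubst] in h', h2' |- *;
      rewrite tsubst_cl in h' |- *;
      change (eqv H' (tsubst s y @ pair Zero Zero) Zero) in h2'.
    + intros a. rewrite coloring_term_eq, h2', ite_0. apply swap_lt; apply head_lt.
    + intros a b h3 h4 h5.
      rewrite !coloring_term_eq, h2', !ite_0 in h5.
      refine (path_proper_coloring h' h2' h3 h4 _).
      (* Being an involution, [swap] is injective, so equal permuted colors come from equal colors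
         on the path. *)
      rewrite <- (swap_involutive H' (cl head_term @ path (tsubst s y) (Succ @ Zero))
        (cl head_term @ path (tsubst s y) (Succ @ a))).
      now rewrite h5, swap_involutive.
  - or_e (zero_or_succ H (y @ pair Zero Zero)) h2 h2.
    (* With the answer 0 at the root, vertex 0 receives its own color swapped with itself, that is
       0. *)
    { rewrite h2, ite_0, swap_diag in h1. exact (lt_irrefl _ h1). }
    clear h1. apply mor_neg_ex; intros H' m h3.
    pose proof (m _ h) as h'. rewrite fsubst_holds in h'. cbn [tsubst] in h'.
    rewrite tsubst_cl in h'. change (tsubst (shift one) y) with (wk (s := one) y) in h'.
    assert (h4 : prov H' (lt Zero (wk y @ pair Zero Zero))).
    { pose proof (mor_eqv m h2) as h2'.
      change (eqv H' (wk y @ pair Zero Zero)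
                (Succ @ pred (wk y @ pair Zero Zero))) in h2'.
      rewrite h2'. apply lt_0S. }
    assert (E : eqv H' (wk (cl coloring_term @ y) @ Zero)
        (Succ @ pair (pair Zero Zero) (pred (wk y @ pair Zero Zero)))).
    { unfold wk at 1; cbn [tsubst]; rewrite tsubst_cl.
      change (tsubst (shift one) y) with (wk (s := one) y).
      rewrite coloring_term_eq, (pos_elim h4) at 1. now rewrite ite_S. }
    refine (no_coloring h' h4 _ h3). rewrite E. apply le_S.
Qed.

(** The strong form holds because the backward functional never consults the graph: the answers
    alone steer the path, and the answer at the root contains the size of an uncolorable
    subgraph. *)
Lemma swle_TGC_LPO_hat : prov [] (swle (TGC (S K)) LPO_hat).
Proof.
  unfold swle; cbv zeta.
  apply p_exI with (cl questions_term). unfold inst; cbn [fsubst].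
  apply p_exI with (cl coloring_term). unfold inst; cbn [fsubst].
  apply mor_all2; intros H0 _. rewrite !fsubst_holds. cbn [tsubst].
  change (prov H0 (Imp
    (holds LPO_hat (tsubst (up (up (scons (cl coloring_term) idsub)))
        (wk (wk (wk (cl questions_term)))) @ v1) v0)
    (holds (TGC (S K)) v1 (wk (wk (cl coloring_term)) @ v0)))).
  unfold wk; rewrite !tsubst_cl.
  apply imp_intro; intros H _ h. exact (TGC_from_hat h).
Qed.

End Upper.

Unset Implicit Arguments.

Theorem theorem21 : forall k : nat, 2 <= k ->
  iRCA0w_proves
    (And (wle LPO (TGC k)) (swle (TGC k) LPO_hat)).
Proof.
  intros k hk. apply p_andI.
  - apply wle_LPO_TGC; lia.
  - destruct k as [|K]; [lia|]. apply swle_TGC_LPO_hat.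
Qed.
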